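(* Let $K$ be a field, let $\lambda=(\lambda_1,\ldots,\lambda_m)$ be a partition of a positive integer $n$ with $m\ge 2$ and $\lambda_m>0$, and set $k:=\min\{\lambda_{i-1}-\lambda_i \mid i=2,3,\ldots,m\}$. Then the Specht ideal $I_\lambda\subset S=K[x_1,\ldots,x_n]$ admits exactly $n!/(k+1)!$ distinct initial ideals under all monomial orders of $S$; that is, the set $\{\operatorname{in}_<(I_\lambda) \mid < \text{ a monomial order on } S\}$ has exactly $n!/(k+1)!$ elements.
   Context: A partition of $n$ is a non-increasing sequence of non-negative integers $\lambda=(\lambda_1,\ldots,\lambda_m)$ with sum $n$. A tableau of shape $\lambda$ is a bijective filling of the boxes of the Young diagram of $\lambda$ (with $\lambda_i$ left-justified boxes in the $i$-th row, rows numbered from top to bottom) by the integers $1,\ldots,n$; $\mathrm{Tab}(\lambda)$ is the set of these. The Specht polynomial $f_T\in S$ of $T\in\mathrm{Tab}(\lambda)$ is the product of all $x_i-x_j$ such that $i$ and $j$ are in the same column of $T$ and $j$ is in a lower position than $i$. The Specht ideal is $I_\lambda:=\langle f_T\mid T\in\mathrm{Tab}(\lambda)\rangle\subset S$. For a monomial order $<$, $\operatorname{in}_<(I)$ is the ideal generated by the leading monomials of the nonzero elements of $I$. *)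

(* Defs.v *)
(* MathComp, with sets and cardinality from mathcomp-classical and polynomials
   from multinomials. *)
From mathcomp Require Import all_boot all_order all_algebra.
From mathcomp Require Import boolp classical_sets cardinality.
From mathcomp Require Import mpoly.

Set Implicit Arguments.
Unset Strict Implicit.
Unset Printing Implicit Defensive.

Import GRing.Theory.

Local Open Scope classical_set_scope.
Local Open Scope ring_scope.

Definition is_partition (n : nat) (la : seq nat) : Prop :=
  sorted geq la /\ sumn la = n.

(* The minimum of the gaps la_(i-1) - la_i.  The default value of the iterated
   minn is la_1, which is an upper bound of all the gaps, so that it is
   irrelevant as soon as la has at least two parts. *)
Definition min_gap (la : seq nat) : nat :=
  \big[minn/head 0 la]_(1 <= i < size la) (nth 0 la i.-1 - nth 0 la i)%N.

(* A box is a pair (row, column), rows being numbered from top to bottom. *)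
Definition box (la : seq nat) : finType :=
  {r : 'I_(size la) & 'I_(nth 0%N la r)}.

Definition box_row (la : seq nat) (b : box la) : nat := tag b.
Definition box_col (la : seq nat) (b : box la) : nat := tagged b.

(* The entries 1, ..., n are represented by 0, ..., n - 1, as are the indices
   of the variables in {mpoly K[n]}. *)
Definition is_tableau (n : nat) (la : seq nat) (T : box la -> 'I_n) : Prop :=
  bijective T.

Definition specht_poly (K : fieldType) (n : nat) (la : seq nat)
    (T : box la -> 'I_n) : {mpoly K[n]} :=
  \prod_(a : box la)
    \prod_(b : box la | (box_col a == box_col b) && (box_row a < box_row b)%N)
      ('X_(T a) - 'X_(T b)).

Definition ideal_gen (R : comNzRingType) (G : set R) : set R :=
  [set p | exists s : seq (R * R),
     (forall u, u \in s -> G u.2) /\ p = \sum_(u <- s) u.1 * u.2].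

Definition specht_ideal (K : fieldType) (n : nat) (la : seq nat) :
    set {mpoly K[n]} :=
  ideal_gen [set f | exists2 T : box la -> 'I_n,
                       is_tableau T & f = specht_poly K T].
Arguments specht_ideal K n la : clear implicits.

(* le is the reflexive version of the order. *)
Record monomial_order (n : nat) (le : rel 'X_{1..n}) : Prop := MonomialOrder {
  monomial_order_refl : reflexive le;
  monomial_order_anti : antisymmetric le;
  monomial_order_trans : transitive le;
  monomial_order_total : total le;
  monomial_order_ge0 : forall m : 'X_{1..n}, le 0%MM m;
  monomial_order_add : forall m1 m2 m : 'X_{1..n},
    le m1 m2 -> le (m1 + m)%MM (m2 + m)%MM }.

(* No m is a leading monomial of p = 0, whose support is empty. *)
Definition leading_monomial (K : fieldType) (n : nat) (le : rel 'X_{1..n})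
    (p : {mpoly K[n]}) (m : 'X_{1..n}) : Prop :=
  m \in msupp p /\ (forall m', m' \in msupp p -> le m' m).

Definition initial_ideal (K : fieldType) (n : nat) (le : rel 'X_{1..n})
    (I : set {mpoly K[n]}) : set {mpoly K[n]} :=
  ideal_gen [set q | exists p m,
    [/\ I p, leading_monomial le p m & q = 'X_[m]]].

Definition initial_ideals (K : fieldType) (n : nat) (I : set {mpoly K[n]}) :
    set (set {mpoly K[n]}) :=
  [set J | exists2 le : rel 'X_{1..n},
             monomial_order le & J = initial_ideal le I].

(* Main.v *)
Require Import Defs.
From mathcomp Require Import all_boot all_order all_algebra all_fingroup.
From mathcomp Require Import boolp classical_sets cardinality.
From mathcomp Require Import zify ring.
From mathcomp Require Import mpoly.

(** The exponent vector of a monomial is read as a word, with one letter for each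
    variable.  Let the variables increase, [x_0 < x_1 < ...].  The leading monomial
    of a product of Vandermonde determinants, one for each block of a partition of
    the variables into columns, gives to each variable the number of smaller ones
    in its column.  The words that arise in this way are the lattice words, and
    their content (the multiplicities of 0, 1, 2, ...) is the shape of the tableau.

    For every such monomial order the leading monomials of the Specht ideal are
    the words that lie above a lattice word whose content is dominated by [la]
    ([init_word]).
    - They all occur, because the ideal contains the Specht polynomials of all
      shapes dominated by [la] ([color_poly_in_specht]): moving a box of the
      shape amounts to a relation between Vandermonde determinants, which is
      Lagrange interpolation ([color_poly_recolor]).
    - Conversely, any nonzero polynomial has in its support a word above some
      lattice word [e] such that the polynomial does not vanish at some point whose
      coordinates coincide according to the content of [e] ([nonvanishing_point]).
      For an element of the ideal, some Specht polynomial of shape [la] does not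
      vanish there, which forces the content of [e] to be dominated by [la]
      ([specht_nonvanishing_dominated]).  This concerns some monomial of the
      support; reduction makes it the leading one ([lead_init_word]).

    So the initial ideal depends only on the order in which a monomial order sorts
    the variables, every such order occurs, and the number of initial ideals is the
    index in the symmetric group of the group of permutations of the positions that
    preserve the set of words [init_word].  That group consists of the permutations
    of the last [k + 1] positions.  They preserve the set because the last [k + 1]
    letters need not obey the lattice condition ([init_word_tail]).  Nothing else
    does: the exchange of two neighbours never destroys a word in which they
    descend, so the sum of the letters at a given position, over all the words with
    bounded letters, increases weakly with the position.  It increases strictly as
    long as the position is not among the last [k + 1] ones, since some word is then
    destroyed by the exchange ([swap_sensitive_exists]); hence an admissible
    permutation fixes these positions ([preserves_init_fix]). *)

Set Implicit Arguments.
Unset Strict Implicit.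
Unset Printing Implicit Defensive.

Import GRing.Theory.

(** * Lattice words *)

Definition mult (r : nat) (e : seq nat) : nat := count_mem r e.

Definition num_lt (r : nat) (e : seq nat) : nat := count (fun x => x < r) e.

Arguments mult : simpl never.
Arguments num_lt : simpl never.

(** The ballot, or Yamanouchi, condition.  If the letter at position [i] is the
    row of the entry [i], these words encode the standard tableaux. *)
Definition lattice_word (e : seq nat) : Prop :=
  forall i r, mult r.+1 (take i e) <= mult r (take i e).

(** Dominance order on the contents, as long as these are sorted, which is the case
    for lattice words; the definition is also used for other words. *)
Definition dominated (la e : seq nat) : Prop :=
  forall r, num_lt r e <= sumn (take r la).

(** The exponent vectors of the monomials of the initial ideal when the variables
    increase. *)
Definition init_word (la m : seq nat) : Prop :=
  exists e, [/\ all2 leq e m, lattice_word e & dominated la e].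

Lemma all2_leqP (e m : seq nat) :
  reflect (size e = size m /\ forall i, nth 0 e i <= nth 0 m i) (all2 leq e m).
Proof.
elim: e m => [|x e IH] [|y m] /=; try by constructor; case.
- by constructor; split=> // i; rewrite nth_nil.
- apply: (iffP andP) => [[xy /IH [sz le]]|[[sz] le]].
    by split=> [|[|i]]; rewrite ?sz //= le.
  split; first exact: (le 0).
  by apply/IH; split=> // i; apply: (le i.+1).
Qed.

Lemma all2_leq_rcons e m x y :
  all2 leq e m -> x <= y -> all2 leq (rcons e x) (rcons m y).
Proof.
by elim: e m => [|a e IH] [|b m] //=; [move=> _ -> | case/andP=> -> /IH].
Qed.

Lemma mult_nil r : mult r [::] = 0. Proof. by []. Qed.

Lemma mult_cons r x e : mult r (x :: e) = (x == r) + mult r e.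
Proof. by []. Qed.

Lemma mult_cat r e f : mult r (e ++ f) = mult r e + mult r f.
Proof. exact: count_cat. Qed.

Lemma mult_rcons r e x : mult r (rcons e x) = mult r e + (x == r).
Proof. by rewrite -cats1 mult_cat mult_cons addn0. Qed.

Lemma mult_size r e : mult r e <= size e.
Proof. exact: count_size. Qed.

Lemma num_lt_nil r : num_lt r [::] = 0. Proof. by []. Qed.

Lemma num_lt_cons r x e : num_lt r (x :: e) = (x < r) + num_lt r e.
Proof. by []. Qed.

Lemma num_lt_cat r e f : num_lt r (e ++ f) = num_lt r e + num_lt r f.
Proof. exact: count_cat. Qed.

Lemma num_lt_size r e : num_lt r e <= size e.
Proof. exact: count_size. Qed.

Lemma num_ltS r e : num_lt r.+1 e = num_lt r e + mult r e.
Proof.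
by elim: e => // x e IH; rewrite mult_cons !num_lt_cons IH; lia.
Qed.

Lemma num_ltE r e : num_lt r e = \sum_(s < r) mult s e.
Proof.
elim: r => [|r IH]; last by rewrite num_ltS big_ord_recr IH.
by rewrite big_ord0 /num_lt (eq_count (a2 := pred0)) ?count_pred0.
Qed.

Lemma lattice_wordW e r : lattice_word e -> mult r.+1 e <= mult r e.
Proof. by move=> /(_ (size e) r); rewrite take_size. Qed.

Lemma lattice_word_anti e r s :
  lattice_word e -> r <= s -> mult s e <= mult r e.
Proof.
move=> He /subnK <-; elim: (s - r) => // d IH.
by rewrite addSn (leq_trans _ IH) // lattice_wordW.
Qed.

Lemma lattice_word_take e i : lattice_word e -> lattice_word (take i e).
Proof. by move=> He j r; rewrite -take_min; apply: He. Qed.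

Lemma lattice_word_catl w z : lattice_word (w ++ z) -> lattice_word w.
Proof. by move/(lattice_word_take (size w)); rewrite take_size_cat. Qed.

Lemma lattice_word_nil : lattice_word [::].
Proof. by []. Qed.

Lemma lattice_word_rcons e x :
  lattice_word (rcons e x) <->
  lattice_word e /\ (forall r, x = r.+1 -> mult r.+1 e < mult r e).
Proof.
split=> [He|[He Hx] i r].
  split=> [|r xr]; first by move: He; rewrite -cats1 => /lattice_word_catl.
  by have := lattice_wordW r He; rewrite !mult_rcons xr; lia.
case: (leqP i (size e)) => [ie|ie].
  by rewrite -cats1 takel_cat.
rewrite take_oversize ?size_rcons // !mult_rcons.
have := lattice_wordW r He; have := Hx r.
case: (x =P r.+1) => [->|_]; last lia.
by move=> /(_ erefl); lia.
Qed.

(** Only the contents of the earlier letters matter for the later prefixes. *)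
Lemma lattice_word_perm_catl s s' z :
  perm_eq s s' -> lattice_word s' -> lattice_word (s ++ z) ->
  lattice_word (s' ++ z).
Proof.
move=> ss' Hs' Hsz i r; rewrite take_cat; case: ifP => [_|/negbT].
  exact: Hs'.
rewrite -leqNgt => si; have := Hsz i r; rewrite take_cat (perm_size ss').
by rewrite ltnNge si /= !mult_cat /mult !(seq.permP ss').
Qed.

(** A larger letter in front of a smaller one does not help to make it legal. *)
Lemma lattice_word_swap w a b z : b < a ->
  lattice_word (w ++ a :: b :: z) -> lattice_word (w ++ b :: a :: z).
Proof.
move=> ba; have E x y : w ++ x :: y :: z = rcons (rcons w x) y ++ z.
  by rewrite -!cats1 -!catA.
rewrite !E => H; apply: (lattice_word_perm_catl _ _ H).
  by rewrite -!cats1 -!catA perm_cat2l /= (perm_catC [:: a] [:: b]).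
move/lattice_word_catl: H.
move=> /lattice_word_rcons [/lattice_word_rcons [Hw Ha] Hb].
apply/lattice_word_rcons; split.
  apply/lattice_word_rcons; split=> // r br; have := Hb r br.
  by rewrite !mult_rcons; lia.
by move=> r ar; have := Ha r ar; rewrite !mult_rcons; lia.
Qed.

(** Append, as long as a letter is missing, the smallest one: its predecessor
    already has its final multiplicity. *)
Lemma lattice_word_fill (w : seq nat) (mu : nat -> nat) (R : nat) :
  lattice_word w -> (forall r, mu r.+1 <= mu r) ->
  (forall r, mult r w <= mu r) -> (forall r, R <= r -> mu r = 0) ->
  exists z, lattice_word (w ++ z) /\ forall r, mult r (w ++ z) = mu r.
Proof.
move=> + mu_anti + muR.
have [N] := ubnP (\sum_(r < R) (mu r - mult r w)).
elim: N w => // N IH w ltN Hw wmu.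
case: (boolP [exists r : 'I_R, mult r w < mu r]); last first.
  move=> /existsPn full; exists [::]; rewrite cats0; split=> // r.
  apply/eqP; rewrite eqn_leq wmu /=.
  case: (ltnP r R) => [rR|/muR->//].
  by have := full (Ordinal rR); rewrite -leqNgt.
move=> ex; have {ex} ex : exists r, (r < R) && (mult r w < mu r).
  by case/existsP: ex => r Hr; exists r; rewrite ltn_ord.
case: (ex_minnP ex) => r /andP[rR Hr] rmin.
have Hwr : lattice_word (rcons w r).
  apply/lattice_word_rcons; split=> // s rs.
  rewrite -rs; case: (ltnP (mult s w) (mu s)) => [lt|ge].
    by have := rmin s; rewrite lt; lia.
  by apply: leq_trans (leq_trans Hr _) ge; rewrite rs.
case: (IH (rcons w r) _ Hwr) => [|s|z [Hz cz]].
- rewrite (leq_trans _ (ltnSE ltN)) // (bigD1 (Ordinal rR)) //=.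
  rewrite [X in _ < X](bigD1 (Ordinal rR)) //=.
  rewrite -addSn leq_add //.
    by rewrite mult_rcons eqxx; lia.
  by apply: leq_sum => s _; rewrite mult_rcons; lia.
- rewrite mult_rcons; have := wmu s.
  by case: (r =P s) => [<-|]; lia.
- by exists (r :: z); rewrite -cat_rcons.
Qed.

Lemma sumn_takeS la r : sumn (take r.+1 la) = sumn (take r la) + nth 0 la r.
Proof.
case: (ltnP r (size la)) => rs; first by rewrite (take_nth 0) // sumn_rcons.
by rewrite !take_oversize ?nth_default ?addn0 // ltnW.
Qed.

Lemma lattice_word_first_violation e : ~ lattice_word e ->
  exists w t z, [/\ e = w ++ t.+1 :: z, lattice_word w,
                    mult t.+1 w = mult t w
                  & ~ lattice_word (rcons w t.+1)].
Proof.
elim/last_ind: e => [|e x IH] nl; first by case: nl.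
have [He|nHe] := boolp.EM (lattice_word e); last first.
  have [w [t [z [-> ? ? ?]]]] := IH nHe.
  by exists w, t, (rcons z x); rewrite rcons_cat.
case: x nl => [|t] nl.
  by case: nl; apply/lattice_word_rcons.
exists e, t, [::]; rewrite cats1; split=> //.
apply/eqP; rewrite eqn_leq lattice_wordW // leqNgt; apply/negP => lt.
by apply: nl; apply/lattice_word_rcons; split=> // r [<-].
Qed.

(** If all gaps of [la] are at least [k], the last [k + 1] letters need not obey
    the lattice condition: at the first violation, the letter [t + 1] can be
    lowered to [t].  Were the bound on the number of letters at most [t] then
    exceeded, [t] would finally occur at least [k] times more often than [t + 1],
    which the at most [k] letters after the violation, where [t + 1] gets ahead of
    [t], cannot achieve. *)
Lemma init_word_tail la k p e :
  (forall r, r.+1 < size la -> nth 0 la r.+1 + k <= nth 0 la r) ->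
  size e = sumn la -> size e <= p + k.+1 ->
  lattice_word (take p e) -> dominated la e -> init_word la e.
Proof.
move=> gap; have [N] := ubnP (sumn e).
elim: N e => // N IH e ltN se sp Hp dom.
have [He|/lattice_word_first_violation] := boolp.EM (lattice_word e).
  by exists e; split=> //; apply/all2_leqP.
move=> [w [t [z [eE Hw ct nw]]]].
have pw : p <= size w.
  rewrite leqNgt; apply/negP => lt; apply: nw.
  apply: (@lattice_word_catl _ (take (p - size w).-1 z)).
  move: Hp; rewrite eE take_cat ltnNge (ltnW lt) /=.
  case E : (p - size w) => [|q]; first lia.
  by rewrite /= cat_rcons.
have sz : size z <= k.
  by move: sp; rewrite eE size_cat /=; lia.
have ctz : mult t z <= size z := mult_size _ _.
pose e1 := w ++ t :: z.
have strict : num_lt t.+1 e < sumn (take t.+1 la).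
  rewrite ltnNge; apply/negP => ge.
  have := dom t; have := dom t.+2; rewrite !num_ltS !sumn_takeS.
  move: ge; rewrite num_ltS sumn_takeS.
  have : mult t.+1 e = mult t w + (mult t.+1 z).+1.
    by rewrite eE mult_cat mult_cons eqxx ct; lia.
  have : mult t e = mult t w + mult t z.
    by rewrite eE mult_cat mult_cons; lia.
  case: (ltnP t.+1 (size la)) => [lt|ge].
    by have := gap _ lt; lia.
  rewrite [nth _ _ t.+1]nth_default // => _ c1 s1 s2 s3.
  have s4 : sumn (take t la) + nth 0 la t = size e.
    by rewrite -sumn_takeS take_oversize // -se.
  by have := num_lt_size t.+2 e; rewrite !num_ltS; lia.
have dom1 : dominated la e1.
  move=> r; have := dom r; rewrite /e1 eE !num_lt_cat !num_lt_cons.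
  case: (r =P t.+1) => [->|]; last lia.
  by move: strict; rewrite eE num_lt_cat num_lt_cons; lia.
case: (IH e1) => //.
- by move: ltN; rewrite /e1 eE !sumn_cat /=; lia.
- by rewrite -se /e1 eE !size_cat.
- by move: sp; rewrite /e1 eE !size_cat.
- by move: Hp; rewrite /e1 eE !takel_cat.
move=> e2 [/all2_leqP [s2 le2] He2 dom2]; exists e2; split=> //.
apply/all2_leqP; split=> [|i]; first by rewrite s2 /e1 eE !size_cat.
apply: leq_trans (le2 i) _; rewrite /e1 eE !nth_cat.
by case: ifP => // _; case: (i - size w).
Qed.

Lemma init_word_up la m m' : all2 leq m m' -> init_word la m -> init_word la m'.
Proof.
move=> /all2_leqP [szm mm'] [e [/all2_leqP [sze em] He dom]].
exists e; split=> //; apply/all2_leqP; split; first by rewrite sze.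
by move=> i; apply: leq_trans (em i) (mm' i).
Qed.

(** If the two letters of the lattice word below descend, they are exchanged as
    well; otherwise both are at most [b] and fit in either position. *)
Lemma init_word_swap la w a b z : b < a ->
  init_word la (w ++ a :: b :: z) -> init_word la (w ++ b :: a :: z).
Proof.
move=> ba [e [em He dom]].
have [sz le] := all2_leqP _ _ em.
have [ew [x [y [ez [eE szw]]]]] : exists ew x y ez,
    e = ew ++ x :: y :: ez /\ size ew = size w.
  have := cat_take_drop (size w) e; have szd : size (drop (size w) e) = (size z).+2.
    by rewrite size_drop sz size_cat /=; lia.
  case: (drop _ _) szd => [|x [|y ez]] // _ <-.
  exists (take (size w) e), x, y, ez; split=> //.
  by rewrite size_take sz size_cat /=; case: ltnP; lia.
have xa : x <= a by have := le (size w); rewrite eE !nth_cat szw ltnn subnn.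
have yb : y <= b.
  by have := le (size w).+1; rewrite eE !nth_cat szw ltnNge leqnSn subSnn.
have Hcat c d : x <= c -> y <= d -> all2 leq e (w ++ c :: d :: z).
  move=> xc yd; apply/all2_leqP; split; first by rewrite sz !size_cat.
  move=> i; have := le i; rewrite eE !nth_cat szw; case: ifP => // _.
  by case: (i - size w) => [|[|j]].
have [xy|yx] := leqP x y.
  by exists e; split=> //; apply: Hcat; lia.
exists (ew ++ y :: x :: ez); split.
- apply/all2_leqP; split; first by move: sz; rewrite eE !size_cat.
  move=> i; have := le i; rewrite eE !nth_cat szw; case: ifP => // _.
  by case: (i - size w) => [|[|j]].
- by apply: lattice_word_swap => //; rewrite -eE.
- by move=> r; have := dom r; rewrite eE !num_lt_cat !num_lt_cons; lia.
Qed.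

Lemma all2_leq_mnm n (m m' : 'X_{1..n}) :
  (forall i, m i <= m' i) -> all2 leq m m'.
Proof.
move=> mm'; apply/all2_leqP; split=> [|i]; first by rewrite !size_tuple.
case: (ltnP i n) => ilt; last by rewrite !nth_default ?size_tuple.
by rewrite -!(mnm_nth 0 _ (Ordinal ilt)).
Qed.

(** * Positions where two neighbouring letters cannot be exchanged *)

Lemma num_lt_all r e : (forall s, r <= s -> mult s e = 0) -> num_lt r e = size e.
Proof.
elim: e => // x e IH H; rewrite num_lt_cons /= IH => [|s rs].
  have := H x; rewrite mult_cons eqxx; lia.
by have := H s rs; rewrite mult_cons; lia.
Qed.

Lemma num_lt_addn_ge q h b e :
  (forall r, q <= r < q + h -> b <= mult r e) ->
  num_lt q e + h * b <= num_lt (q + h) e.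
Proof.
elim: h => [|h IH] H; first by rewrite !addn0.
rewrite addnS num_ltS mulSn addnCA addnC leq_add ?IH //.
  by move=> r Hr; apply: H; lia.
by apply: H; lia.
Qed.

Lemma num_lt_addn_le q h b e :
  (forall r, q <= r < q + h -> mult r e <= b) ->
  num_lt (q + h) e <= num_lt q e + h * b.
Proof.
elim: h => [|h IH] H; first by rewrite !addn0.
rewrite addnS num_ltS mulSn addnCA addnC leq_add ?IH //.
  by apply: H; lia.
by move=> r Hr; apply: H; lia.
Qed.

Lemma mult_iota r p j : mult r (iota p j) = (p <= r < p + j).
Proof. by rewrite /mult count_uniq_mem ?iota_uniq // mem_iota. Qed.

Lemma lattice_word_iota u p j : lattice_word u ->
  (forall r, p <= r -> mult r u = 0) -> (forall r, p = r.+1 -> 0 < mult r u) ->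
  lattice_word (u ++ iota p j).
Proof.
move=> Hu u0 up; elim: j => [|j IH]; first by rewrite cats0.
rewrite -addn1 iotaD /= cats1 -rcons_cat; apply/lattice_word_rcons; split=> //.
move=> r pjr; rewrite !mult_cat !mult_iota.
by have := u0 r.+1; have := u0 r; have := up r; lia.
Qed.

Lemma all2_leq_num_lt q e m : all2 leq e m -> num_lt q m <= num_lt q e.
Proof.
elim: e m => [|x e IH] [|y m] //= /andP[xy /IH].
by rewrite !num_lt_cons; lia.
Qed.

(** Lowering letters moves none of them out of the range below [q]; if their number
    there stays the same, none has moved into it either. *)
Lemma all2_leq_num_lt_map q e m : all2 leq e m -> num_lt q e <= num_lt q m ->
  [seq x < q | x <- e] = [seq x < q | x <- m].
Proof.
elim: e m => [|x e IH] [|y m] //= /andP[xy em].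
have := all2_leq_num_lt q em; rewrite !num_lt_cons => H1 H2.
congr (_ :: _); first by apply/idP/idP; lia.
by apply: IH => //; lia.
Qed.

Lemma num_lt_map q e m :
  [seq x < q | x <- e] = [seq x < q | x <- m] -> num_lt q e = num_lt q m.
Proof. by move=> /(congr1 (count id)); rewrite !count_map. Qed.

Lemma mult_ge_map q e m : all2 leq e m ->
  [seq x < q | x <- e] = [seq x < q | x <- m] -> mult q m <= mult q e.
Proof.
elim: e m => [|x e IH] [|y m] //= /andP[xy em] [exy /(IH _ em)].
by rewrite !mult_cons; lia.
Qed.

Lemma mult_le_map q e m : all2 leq e m ->
  [seq x < q.+1 | x <- e] = [seq x < q.+1 | x <- m] -> mult q e <= mult q m.
Proof.
elim: e m => [|x e IH] [|y m] //= /andP[xy em] [exy /(IH _ em)].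
by rewrite !mult_cons; lia.
Qed.

Lemma all2_leq_take i e m : all2 leq e m -> all2 leq (take i e) (take i m).
Proof.
by elim: i e m => [|i IH] [|x e] [|y m] //= /andP[-> /IH].
Qed.

(** A tie between [q] and [q + 1] after [w] blocks an immediate [q + 1]; lowering
    letters to avoid it increases the number of letters at most [q]. *)
Lemma not_init_word_tie la q w m :
  mult q.+1 w = mult q w ->
  sumn (take q.+1 la) <= num_lt q.+1 (w ++ q.+1 :: m) ->
  ~ init_word la (w ++ q.+1 :: m).
Proof.
move=> tie sat [e [em He /(_ q.+1) dom]].
have := all2_leq_num_lt_map em (leq_trans dom sat).
move/(congr1 (take (size w).+1)); rewrite -!map_take.
have := all2_leq_take (size w).+1 em.
rewrite -cat_rcons take_size_cat ?size_rcons // => le1 eq1.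
have := mult_ge_map le1 eq1; have := mult_le_map le1 eq1.
have := He (size w).+1 q; rewrite !mult_rcons; lia.
Qed.

(** Here the blocked letters form a single column: below the only letter [q]
    among the first ones, each of the [h + 2] larger letters can occur at most
    once, but they come in an order that leaves no room for the last of them. *)
Lemma not_init_word_column la q u h m :
  (forall r, q <= r -> mult r u = 0) ->
  let w := u ++ iota q h.+1 in
  sumn (take q.+1 la) <= num_lt q.+1 (w ++ (q + h).+2 :: (q + h).+1 :: m) ->
  ~ init_word la (w ++ (q + h).+2 :: (q + h).+1 :: m).
Proof.
move=> u0 w sat [e [em He /(_ q.+1) dom]].
have em1 := all2_leq_num_lt_map em (leq_trans dom sat).
have split2 : w ++ (q + h).+2 :: (q + h).+1 :: m =
              rcons (rcons w (q + h).+2) (q + h).+1 ++ m.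
  by rewrite -!cats1 -!catA.
set P1 := rcons w (q + h).+2; set P2 := rcons P1 (q + h).+1.
have P1E : take (size P1) (w ++ (q + h).+2 :: (q + h).+1 :: m) = P1.
  by rewrite split2 -cats1 -catA take_size_cat.
have P2E : take (size P2) (w ++ (q + h).+2 :: (q + h).+1 :: m) = P2.
  by rewrite split2 take_size_cat.
set e1 := take (size P1) e; set e2 := take (size P2) e.
have l1 : all2 leq e1 P1 by rewrite -P1E; apply: all2_leq_take.
have l2 : all2 leq e2 P2 by rewrite -P2E; apply: all2_leq_take.
have m1 : [seq x < q.+1 | x <- e1] = [seq x < q.+1 | x <- P1].
  by rewrite map_take em1 -map_take P1E.
have m2 : [seq x < q.+1 | x <- e2] = [seq x < q.+1 | x <- P2].
  by rewrite map_take em1 -map_take P2E.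
have H1 : lattice_word e1 by apply: lattice_word_take.
have H2 : lattice_word e2 by apply: lattice_word_take.
have [sz1 _] := all2_leqP _ _ l1; have [sz2 nth2] := all2_leqP _ _ l2.
have wq : num_lt q.+1 w = (size u).+1.
  rewrite num_ltS /w num_lt_cat mult_cat mult_iota u0 // num_lt_all //.
  suff : num_lt q (iota q h.+1) = 0 by lia.
  apply/eqP; rewrite -leqn0 leqNgt -has_count; apply/hasPn => x.
  by rewrite mem_iota; lia.
have szw : size w = size u + h.+1 by rewrite size_cat size_iota.
have n1 : num_lt q.+1 e1 = (size u).+1.
  by rewrite (num_lt_map m1) /P1 -cats1 num_lt_cat wq num_lt_cons num_lt_nil; lia.
have n2 : num_lt q.+1 e2 = (size u).+1.
  rewrite (num_lt_map m2) /P2 /P1 -!cats1 2!num_lt_cat wq !num_lt_cons.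
  by rewrite num_lt_nil; lia.
(* This letter would need all of [q + 1, ..., q + h + 1] in [e1] as well, but only
   [h + 1] letters of [e1] are larger than [q]. *)
have top1 : mult (q.+1 + h.+1) e1 = 0.
  apply/eqP; rewrite -leqn0 leqNgt; apply/negP => pos.
  have : num_lt q.+1 e1 + h.+2 * 1 <= num_lt (q.+1 + h.+2) e1.
    apply: num_lt_addn_ge => r Hr; apply: leq_trans pos _.
    by apply: lattice_word_anti => //; lia.
  have := num_lt_size (q.+1 + h.+2) e1; rewrite n1 sz1 size_rcons szw; lia.
have e2E : e2 = rcons e1 (nth 0 e (size P1)).
  rewrite /e2 /P2 size_rcons (take_nth 0) //.
  have := sz2; rewrite /e2 size_take /P2 size_rcons; case: ifP; lia.
have last_le : nth 0 e (size P1) <= (q + h).+1.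
  have := nth2 (size P1); rewrite /P2 nth_rcons ltnn eqxx /e2 nth_take //.
  by rewrite [size P2]size_rcons.
(* The [h + 2] letters of [e2] larger than [q] are distinct, and take at most
   [h + 1] values. *)
have sat2 : num_lt (q.+1 + h.+1) e2 = size e2.
  apply: num_lt_all => s Hs; rewrite e2E mult_rcons.
  have : mult s e1 <= mult (q.+1 + h.+1) e1 by apply: lattice_word_anti.
  by rewrite top1; lia.
have : num_lt (q.+1 + h.+1) e2 <= num_lt q.+1 e2 + h.+1 * 1.
  apply: num_lt_addn_le => r Hr.
  have : mult r e2 <= mult q e2 by apply: lattice_word_anti => //; lia.
  have := mult_le_map l2 m2.
  rewrite /P2 /P1 !mult_rcons /w mult_cat mult_iota u0 //; lia.
by rewrite sat2 n2 sz2 /P2 /P1 !size_rcons szw; lia.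
Qed.

(** The lowest content in dominance order whose first [q] rows are those of [la] and
    whose next row has [c + 1] boxes: all the rows below have one box. *)
Definition near_hook (la : seq nat) (q c r : nat) : nat :=
  if r < q then nth 0 la r else if r == q then c.+1
  else r < q + (sumn la - sumn (take q la)) - c.

Lemma sumn_take_le la r : sumn (take r la) <= sumn la.
Proof. by rewrite -{2}(cat_take_drop r la) sumn_cat leq_addr. Qed.

Lemma near_hook_dominated la q c e :
  (forall r, r < size la -> 0 < nth 0 la r) -> q < size la ->
  c < nth 0 la q -> (forall r, mult r e = near_hook la q c r) ->
  [/\ num_lt q e = sumn (take q la), dominated la e & size e = sumn la].
Proof.
move=> la_pos qla cq eE.
have low r : r <= q -> num_lt r e = sumn (take r la).
  elim: r => [|r IH] rq; first by rewrite take0 /= num_ltE big_ord0.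
  by rewrite num_ltS sumn_takeS IH ?(ltnW rq) // eE /near_hook rq.
have Sq : sumn (take q la) + nth 0 la q <= sumn la.
  by rewrite -sumn_takeS sumn_take_le.
have high d : num_lt (q.+1 + d) e = sumn (take q la) + c.+1 +
                minn d (sumn la - sumn (take q la) - c.+1).
  elim: d => [|d IH].
    by rewrite addn0 num_ltS low // eE /near_hook ltnn eqxx min0n addn0.
  rewrite addnS num_ltS IH eE /near_hook.
  have -> : (q.+1 + d < q) = false by lia.
  have -> : (q.+1 + d == q) = false by lia.
  lia.
split=> [|r|]; first exact: low.
  have [/low->//|qr] := leqP r q; rewrite -(subnKC qr).
elim: (r - q.+1) => [|d IH].
    by rewrite high addn0 sumn_takeS min0n addn0 leq_add2l.
  rewrite addnS; case: (ltnP (q.+1 + d) (size la)) => Hd.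
    rewrite num_ltS sumn_takeS leq_add // eE /near_hook.
    have -> : (q.+1 + d < q) = false by lia.
    have -> : (q.+1 + d == q) = false by lia.
    by apply: leq_trans (leq_b1 _) _; apply: la_pos.
  rewrite -[(_ + d).+1]addnS high (@take_oversize _ (q.+1 + d.+1)); lia.
rewrite -(@num_lt_all (q.+1 + sumn la)) ?high; first by lia.
move=> r Hr; rewrite eE /near_hook; do 2 (case: ifP => ?; first lia).
by lia.
Qed.

Lemma near_hook_anti la q c :
  (forall r, nth 0 la r.+1 <= nth 0 la r) -> c < nth 0 la q ->
  forall r, near_hook la q c r.+1 <= near_hook la q c r.
Proof.
move=> la_anti cq r; rewrite /near_hook.
case: (ltnP r.+1 q) => r1q; first by rewrite (ltnW r1q).
case: (ltnP r q) => rq.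
  have -> : r.+1 == q by lia.
  have rqE : q = r.+1 by lia.
  by apply: leq_trans cq _; rewrite rqE; apply: la_anti.
have -> : (r.+1 == q) = false by lia.
by case: (r == q); lia.
Qed.

Lemma near_hook_fill la q c w a b :
  (forall r, nth 0 la r.+1 <= nth 0 la r) ->
  (forall r, r < size la -> 0 < nth 0 la r) -> q < size la ->
  c < nth 0 la q -> lattice_word (w ++ [:: a; b]) ->
  (forall r, mult r (w ++ [:: a; b]) <= near_hook la q c r) ->
  exists z, [/\ init_word la (w ++ a :: b :: z),
                num_lt q (w ++ a :: b :: z) = sumn (take q la)
              & size (w ++ a :: b :: z) = sumn la].
Proof.
move=> la_anti la_pos qla cq Hw wmu.
have anti := near_hook_anti la_anti cq.
have [|z [Hz cz]] := lattice_word_fill (R := q + sumn la + 1) Hw anti wmu.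
  move=> r Hr; rewrite /near_hook; do 2 (case: ifP => ?; first lia).
  by lia.
exists z; move: Hz cz; rewrite -catA /= => Hz cz.
have [sat dom sz] := near_hook_dominated la_pos qla cq cz.
by split=> //; exists (w ++ a :: b :: z); split=> //; apply/all2_leqP.
Qed.

Definition swap_sensitive (la : seq nat) (i : nat) : Prop :=
  exists w a b z, [/\ size w = i, size (w ++ a :: b :: z) = sumn la,
                      init_word la (w ++ a :: b :: z)
                    & ~ init_word la (w ++ b :: a :: z)].

Lemma num_lt_swap q w a b z :
  num_lt q (w ++ b :: a :: z) = num_lt q (w ++ a :: b :: z).
Proof. by rewrite !num_lt_cat !num_lt_cons; lia. Qed.

Lemma mult_take_le r i e : mult r (take i e) <= mult r e.
Proof. by rewrite -{2}(cat_take_drop i e) mult_cat leq_addr. Qed.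

(** The first [q + 1] rows are those of [la], and all the other boxes lie in the
    first column.  The positions [i] and [i + 1] get two successive boxes of the
    first column, in rows at least [q]; the first [i] letters fill rows above [q],
    and, if there are too few boxes there, continue with the first column. *)
Lemma swap_sensitive_hook la q i :
  (forall r, nth 0 la r.+1 <= nth 0 la r) ->
  (forall r, r < size la -> 0 < nth 0 la r) -> q.+1 < size la ->
  q <= i -> i + nth 0 la q < sumn la -> swap_sensitive la i.
Proof.
move=> la_anti la_pos qla qi ile.
pose mu r := if r < q then nth 0 la r else 0.
have mu_anti r : mu r.+1 <= mu r.
  by rewrite /mu; case: ifP => // r1q; rewrite (ltnW r1q) la_anti.
have iota_mult r : mult r (iota 0 q) = (r < q) by rewrite mult_iota.
have Hiota : lattice_word (iota 0 q).
  exact: (@lattice_word_iota [::]).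
have [|r|z0] := lattice_word_fill (R := q) Hiota mu_anti.
- move=> r; rewrite iota_mult /mu; case: ifP => // rq.
  by apply: la_pos; lia.
- by rewrite /mu; case: ltnP.
set u := _ ++ z0 => -[Hu cu].
have u0 r : q <= r -> mult r u = 0 by move=> qr; rewrite cu /mu ltnNge qr.
have szu : size u = sumn (take q la).
  rewrite -(num_lt_all u0).
  elim: {-2}(q) (leqnn q) => [|r IH] rq; first by rewrite num_ltE big_ord0 take0.
  by rewrite num_ltS sumn_takeS IH 1?ltnW // cu /mu rq.
have cpos : 0 < nth 0 la q.+1 by apply: la_pos.
have mqE r : near_hook la q.+1 0 r = if r < q.+1 then nth 0 la r else
       (r < q.+1 + (sumn la - sumn (take q.+1 la))).
  rewrite /near_hook subn0; case: ltnP => // qr; case: eqP => // rq.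
  have := sumn_take_le la q.+2; rewrite sumn_takeS; lia.
have [iu|ui] := leqP i (size u).
- pose w := take i u.
  have w0 r : q <= r -> mult r w = 0.
    by move=> qr; apply/eqP; rewrite -leqn0 -(u0 _ qr) mult_take_le.
  have wpos r : q = r.+1 -> 0 < mult r w.
    move=> qr; rewrite /w /u take_cat size_iota [i < q]ltnNge qi /=.
    rewrite mult_cat iota_mult.
    by rewrite qr ltnSn.
  have [||z [good sat sz]] :=
    @near_hook_fill la q.+1 0 w q q.+1 la_anti la_pos qla cpos.
  + by apply: (@lattice_word_iota _ q 2) => //; apply: lattice_word_take.
  + move=> r; rewrite mqE mult_cat !mult_cons mult_nil.
    have wu : mult r w <= mult r u by apply: mult_take_le.
    move: wu; rewrite cu /mu; have := la_pos r.
    have := sumn_take_le la q.+2; rewrite sumn_takeS.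
    by do ![case: ifP]; lia.
  exists w, q, q.+1, z; split=> //; first by rewrite size_take; case: ltnP; lia.
  apply: not_init_word_tie; first by rewrite !w0.
  by rewrite num_lt_swap sat.
- pose h := i - (size u).+1.
  pose w := u ++ iota q h.+1.
  have szw : size w = i by rewrite size_cat size_iota /h; lia.
  have bnd : q.+1 + h.+1 < q.+1 + (sumn la - sumn (take q.+1 la)).
    by rewrite sumn_takeS -szu /h; lia.
  have [||z [good sat sz]] :=
    @near_hook_fill la q.+1 0 w (q + h).+1 (q + h).+2 la_anti la_pos qla cpos.
  + have -> : w ++ [:: (q + h).+1; (q + h).+2] = u ++ iota q (h.+1 + 2).
      by rewrite iotaD /w -catA /= addnS.
    apply: (@lattice_word_iota u q _ Hu u0) => r qr; rewrite cu /mu qr ltnSn.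
    by apply: la_pos; lia.
  + move=> r; rewrite mqE 2!mult_cat mult_iota !mult_cons mult_nil cu /mu.
    have := la_pos r.
    by do ![case: ifP]; lia.
  exists w, (q + h).+1, (q + h).+2, z; split=> //.
  by apply: not_init_word_column => //; rewrite num_lt_swap sat.
Qed.

(** Rows [q] and [q + 1] are tied at [c] when the positions [i] and [i + 1] add one
    box to each of them.  All the letters that follow are [q]; their number
    [la_q - c - 1] determines [c] from [i], and the equation between [la_q] and
    [la_(q + 1)] makes [c + 1] fit into row [q + 1]. *)
Lemma swap_sensitive_gap la k q i :
  (forall r, nth 0 la r.+1 <= nth 0 la r) ->
  (forall r, r < size la -> 0 < nth 0 la r) -> q.+1 < size la ->
  nth 0 la q = nth 0 la q.+1 + k ->
  sumn la <= i + nth 0 la q -> i + k + 2 <= sumn la -> swap_sensitive la i.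
Proof.
move=> la_anti la_pos qla gap ile ige.
have Sq := sumn_take_le la q.+2; rewrite !sumn_takeS in Sq.
pose c := i + nth 0 la q - sumn la + 1.
have cq : c < nth 0 la q.+1 by rewrite /c; lia.
have c0 : 0 < c by rewrite /c; lia.
pose Q := sumn la - sumn (take q la) - nth 0 la q.
pose nu r := if r < q then nth 0 la r else if r < q.+2 then c
             else nat_of_bool (r < q.+1 + Q - c).
have nu_anti r : nu r.+1 <= nu r.
  rewrite /nu; case: (ltnP r.+1 q) => r1q; first by rewrite (ltnW r1q).
  case: (ltnP r q) => rq; last by do ![case: ifP]; lia.
  have -> : r.+1 < q.+2 by lia.
  have -> : r = q.-1 by lia.
  have := la_anti q.-1; have := la_anti q; rewrite prednK; lia.
have [//|r|w] := @lattice_word_fill [::] nu (q.+2 + Q) lattice_word_nil nu_anti.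
  by rewrite /nu; do ![case: ifP]; lia.
rewrite cat0s => -[Hw cw].
have szw : size w = i.
  rewrite -(@num_lt_all (q.+2 + Q)); last first.
    by move=> s; rewrite cw /nu; do ![case: ifP]; lia.
  have low r : r <= q -> num_lt r w = sumn (take r la).
    elim: r => [|r IH] rq; first by rewrite take0 /= num_ltE big_ord0.
    by rewrite num_ltS sumn_takeS IH ?(ltnW rq) // cw /nu rq.
  have high d : num_lt (q.+2 + d) w = sumn (take q la) + c + c + minn d (Q - c - 1).
    elim: d => [|d IH].
      by rewrite addn0 min0n !num_ltS low // !cw /nu; do ![case: ifP]; lia.
    rewrite addnS num_ltS IH cw /nu.
    have -> : (q.+2 + d < q) = false by lia.
    have -> : (q.+2 + d < q.+2) = false by lia.
    lia.
  by rewrite high /Q /c; lia.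
have [||z [good sat sz]] :=
  @near_hook_fill la q.+1 c w q q.+1 la_anti la_pos qla cq.
- have -> : w ++ [:: q; q.+1] = rcons (rcons w q) q.+1.
    by rewrite -!cats1 -catA.
  apply/lattice_word_rcons; split; last first.
    by move=> r [<-]; rewrite !mult_rcons !cw /nu; do ![case: ifP]; lia.
  apply/lattice_word_rcons; split=> // r qr; rewrite !cw /nu qr ltnn ltnSn.
  have := la_anti q; have := la_anti r; rewrite qr in cq *.
  by case: ifP; lia.
- move=> r; rewrite mult_cat !mult_cons mult_nil cw /nu /near_hook sumn_takeS.
  have [->|rq] := eqVneq r q; first by do ![case: ifP]; lia.
  have [->|rq1] := eqVneq r q.+1; first by do ![case: ifP]; lia.
  by rewrite /Q; do ![case: ifP]; lia.
exists w, q, q.+1, z; split=> //.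
apply: not_init_word_tie; last by rewrite num_lt_swap sat.
by rewrite !cw /nu; do ![case: ifP]; lia.
Qed.

Lemma size_le_sumn la :
  (forall r, r < size la -> 0 < nth 0 la r) -> size la <= sumn la.
Proof.
elim: la => // x la IH pos /=.
have := pos 0 isT; have := IH (fun r => pos r.+1); rewrite /=; lia.
Qed.

(** The two constructions for row [q] cover the positions from [q] on; the earlier
    ones are covered by the hook whose arm is the first row. *)
Lemma swap_sensitive_exists la k q i :
  (forall r, nth 0 la r.+1 <= nth 0 la r) ->
  (forall r, r < size la -> 0 < nth 0 la r) -> q.+1 < size la ->
  nth 0 la q = nth 0 la q.+1 + k -> i + k + 2 <= sumn la -> swap_sensitive la i.
Proof.
move=> la_anti la_pos qla gap ile.
have [/swap_sensitive_gap|small] := leqP (sumn la) (i + nth 0 la q).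
  by move/(_ _ la_anti la_pos qla gap); apply.
have [qi|iq] := leqP q i; first exact: (swap_sensitive_hook la_anti la_pos qla).
apply: (@swap_sensitive_hook la 0) => //; first by lia.
case: la la_pos qla {la_anti gap ile small} => // x la pos qla.
by have := @size_le_sumn la (fun r => pos r.+1); rewrite /= in qla *; lia.
Qed.

(** * The standard tableau of a lattice word *)

Lemma partition_anti la : sorted geq la ->
  forall r, (nth 0 la r.+1 <= nth 0 la r)%N.
Proof.
move=> la_sorted r; case: (ltnP r.+1 (size la)) => rs; last by rewrite nth_default.
have := sorted_leq_nth (leT := geq) _ _ _ la_sorted.
apply => //; rewrite ?inE; try lia.
- by move=> y x z; rewrite /geq /=; lia.
- by move=> x; rewrite /geq /=.
Qed.

(** The number of boxes in the first [c] columns. *)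
Definition num_boxes (la : seq nat) (c : nat) : nat :=
  \sum_(l <- la) minn l c.

Lemma num_boxesS la c :
  num_boxes la c.+1 = num_boxes la c + count (fun l => c < l) la.
Proof.
rewrite /num_boxes -sum1_count [X in _ = _ + X]big_mkcond -big_split /=.
by apply: eq_bigr => l _; case: ifP; lia.
Qed.

Lemma num_boxes_le la c : num_boxes la c <= sumn la.
Proof. by rewrite sumnE /num_boxes leq_sum // => l _; apply: geq_minl. Qed.

Lemma num_boxes_max la c : (forall r, nth 0 la r.+1 <= nth 0 la r) ->
  head 0 la <= c -> num_boxes la c = sumn la.
Proof.
move=> la_anti hc; rewrite sumnE /num_boxes !big_seq; apply: eq_bigr => l.
move=> /(nthP 0) [r _ <-]; apply/minn_idPl; apply: leq_trans hc.
by rewrite -nth0; elim: r => // r; apply: leq_trans.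
Qed.

Lemma row_lt_col_height la r c : (forall r, nth 0 la r.+1 <= nth 0 la r) ->
  c < nth 0 la r -> r < count (fun l => c < l) la.
Proof.
elim: la r => [|x la IH] r anti; first by rewrite nth_nil.
have anti' r' := anti r'.+1.
case: r => [|r] /= cr; first by rewrite cr.
have := IH r anti' cr; suff -> : c < x by lia.
apply: leq_trans cr _; elim: r {IH} => [|r IHr]; first exact: (anti 0).
exact: leq_trans (anti' r) IHr.
Qed.

(** The columns of the boxes in the standard tableau encoded by a lattice word:
    the letter at position [i] is the row of the entry [i]. *)
Definition columns (e : seq nat) : seq nat :=
  [seq mult (nth 0 e i) (take i e) | i <- iota 0 (size e)].

Lemma size_columns e : size (columns e) = size e.
Proof. by rewrite size_map size_iota. Qed.

Lemma columns_rcons e x : columns (rcons e x) = rcons (columns e) (mult x e).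
Proof.
rewrite /columns size_rcons -addn1 iotaD map_cat /= cats1 add0n.
have -> : take (size e) (rcons e x) = e by rewrite -cats1 take_size_cat.
rewrite nth_rcons ltnn eqxx; congr rcons.
apply/eq_in_map => i; rewrite mem_iota add0n => /andP[_ ie].
by rewrite nth_rcons ie -cats1 takel_cat // ltnW.
Qed.

Lemma take_columns i e : take i (columns e) = columns (take i e).
Proof.
elim/last_ind: e => [|e x IH]; first by rewrite /columns.
rewrite columns_rcons; case: (leqP i (size e)) => ie.
  by rewrite -!cats1 !takel_cat ?size_columns // IH.
by rewrite !take_oversize ?size_rcons ?size_columns // columns_rcons.
Qed.

Lemma mult_columns R c e : (forall r, R <= r -> mult r e = 0) ->
  mult c (columns e) = \sum_(r < R) (c < mult r e).
Proof.
elim/last_ind: e => [|e x IH] eR.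
  by rewrite big1 // => r _; rewrite mult_nil.
have xR : x < R.
  by rewrite ltnNge; apply/negP => /eR; rewrite mult_rcons eqxx addn1.
rewrite columns_rcons mult_rcons IH; last first.
  by move=> r /eR; rewrite mult_rcons; lia.
rewrite (bigD1 (Ordinal xR)) //= [RHS](bigD1 (Ordinal xR)) //=.
rewrite addnAC mult_rcons eqxx; congr (_ + _); first by lia.
apply: eq_bigr => r rx; rewrite mult_rcons.
by have /negbTE -> : x != r; rewrite ?addn0 // eq_sym -val_eqE in rx *.
Qed.

Lemma num_lt_columns R c e : (forall r, R <= r -> mult r e = 0) ->
  num_lt c (columns e) = \sum_(r < R) minn (mult r e) c.
Proof.
elim/last_ind: e => [|e x IH] eR.
  by rewrite big1 // => r _; rewrite mult_nil min0n.
have xR : x < R.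
  by rewrite ltnNge; apply/negP => /eR; rewrite mult_rcons eqxx addn1.
rewrite columns_rcons -cats1 num_lt_cat num_lt_cons num_lt_nil IH; last first.
  by move=> r /eR; rewrite mult_rcons; lia.
rewrite (bigD1 (Ordinal xR)) //= [RHS](bigD1 (Ordinal xR)) //=.
rewrite addnAC mult_rcons eqxx; congr (_ + _); first by lia.
apply: eq_bigr => r rx; rewrite mult_rcons.
by have /negbTE -> : x != r; rewrite ?addn0 // eq_sym -val_eqE in rx *.
Qed.

Lemma mult_eq0_large e : exists R, forall r, R <= r -> mult r e = 0.
Proof.
elim: e => [|x e [R IH]]; first by exists 0.
exists (maxn R x.+1) => r; rewrite geq_max => /andP[/IH Rr xr].
by rewrite mult_cons Rr; lia.
Qed.

(** The entry in row [x] has exactly [x] entries above it in its column. *)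
Lemma mult_columns_last e x : lattice_word (rcons e x) ->
  mult (mult x e) (columns e) = x.
Proof.
move=> /lattice_word_rcons [He Hx]; have [R eR] := mult_eq0_large e.
rewrite (@mult_columns (maxn R x)); last first.
  by move=> r; rewrite geq_max => /andP[/eR].
rewrite -[RHS]card_ord -sum1_card (big_ord_widen _ (fun=> 1) (leq_maxr R x)).
rewrite [RHS]big_mkcond; apply: eq_bigr => r _.
case: (ltnP (mult x e) (mult r e)) => [lt|le]; case: (ltnP r x) => [rx|xr] //.
  by have := lattice_word_anti He xr; rewrite leqNgt lt.
have x_gt0 : 0 < x by apply: leq_ltn_trans rx.
have := Hx x.-1; rewrite prednK // => /(_ erefl).
have : mult x.-1 e <= mult r e by apply: lattice_word_anti => //; lia.
by move: le; lia.
Qed.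

(** Conjugation reverses the dominance order. *)
Lemma dominated_columns la e : lattice_word e -> dominated la e ->
  size e = sumn la -> forall c, num_boxes la c <= num_lt c (columns e).
Proof.
move=> He dom sz c; have [R eR] := mult_eq0_large e.
rewrite (num_lt_columns c eR).
have ex : exists r, mult r e <= c by exists R; rewrite eR.
have [r rc rmin] := ex_minnP ex.
have rR : r <= R by apply: rmin; rewrite eR.
have sumR : size e = \sum_(0 <= s < R) mult s e.
  by rewrite -(num_lt_all eR) num_ltE big_mkord.
have sumr : num_lt r e = \sum_(0 <= s < r) mult s e by rewrite num_ltE big_mkord.
rewrite -(big_mkord predT (fun s => minn (mult s e) c)).
rewrite (@big_cat_nat _ _ _ r) //=.
have low : \sum_(0 <= s < r) minn (mult s e) c = r * c.
  rewrite big_mkord -[X in X * c]card_ord -sum_nat_const; apply: eq_bigr => s _.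
  apply/minn_idPr; rewrite leqNgt; apply/negP => /ltnW /rmin.
  by rewrite leqNgt ltn_ord.
have high : \sum_(r <= s < R) minn (mult s e) c = \sum_(r <= s < R) mult s e.
  apply: eq_big_nat => s /andP[rs _]; apply/minn_idPl.
  exact: leq_trans (lattice_word_anti He rs) rc.
have := dom r; rewrite low high sumr => domr.
have : \sum_(0 <= s < R) mult s e =
       \sum_(0 <= s < r) mult s e + \sum_(r <= s < R) mult s e.
  by rewrite -big_cat_nat.
rewrite -sumR sz -{1}(cat_take_drop r la) sumn_cat => sumE.
have boxes : num_boxes la c <= r * c + sumn (drop r la).
  rewrite /num_boxes -{1}(cat_take_drop r la) big_cat leq_add //=; last first.
    exact: num_boxes_le.
  apply: (@leq_trans (\sum_(l <- take r la) c)).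
    by apply: leq_sum => l _; apply: geq_minr.
  rewrite big_const_seq count_predT iter_addn_0 mulnC leq_mul2r size_take_min.
  by rewrite geq_minl orbT.
lia.
Qed.

Lemma nth_columns e i : i < size e ->
  nth 0 (columns e) i = mult (nth 0 e i) (take i e).
Proof. by move=> ie; rewrite (nth_map 0) ?size_iota // nth_iota. Qed.

Lemma mult_take_columns e i : lattice_word e -> i < size e ->
  mult (nth 0 (columns e) i) (take i (columns e)) = nth 0 e i.
Proof.
move=> He ie; rewrite nth_columns // take_columns; apply: mult_columns_last.
by rewrite -take_nth //; apply: lattice_word_take.
Qed.

(** * A point where a polynomial does not vanish *)

Local Open Scope ring_scope.

Definition mnm_rcons n (m : 'X_{1..n}) (d : nat) : 'X_{1..n.+1} :=
  Multinom [tuple of rcons m d].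

Lemma mnm_rcons_widen n (m : 'X_{1..n}) d (i : 'I_n) :
  mnm_rcons m d (widen_ord (leqnSn n) i) = m i.
Proof. by rewrite !(mnm_nth 0) /= nth_rcons size_tuple ltn_ord. Qed.

Lemma mnm_rcons_max n (m : 'X_{1..n}) d : mnm_rcons m d ord_max = d.
Proof. by rewrite (mnm_nth 0) /= nth_rcons size_tuple ltnn eqxx. Qed.

Lemma mcoeff_muni (K : nzRingType) n (p : {mpoly K[n.+1]}) d m :
  ((muni p)`_d)@_m = p@_(mnm_rcons m d).
Proof.
rewrite muniE coef_sum raddf_sum [in RHS](mpolyE p) raddf_sum /=.
apply: eq_bigr => u _; rewrite mcoeffZ mcoeffX coefZ coefXn.
have -> : (u == mnm_rcons m d) =
    ([multinom u (widen_ord (leqnSn n) i) | i < n] == m) && (d == u ord_max).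
  apply/eqP/andP => [->|[/eqP <- /eqP ->]].
    by split; apply/eqP; [apply/mnmP => i; rewrite mnmE mnm_rcons_widen
                        | rewrite mnm_rcons_max].
  apply/mnmP => i; case: (unliftP ord_max i) => [j ->|->].
    have -> : lift ord_max j = widen_ord (leqnSn n) j.
      by apply: val_inj; rewrite /= /bump leqNgt ltn_ord.
    by rewrite mnm_rcons_widen mnmE.
  by rewrite mnm_rcons_max.
case: (d == _); last by rewrite mulr0 mcoeff0 andbF mulr0.
by rewrite mulr1 mcoeffZ mcoeffX andbT.
Qed.

Lemma mmap_muni (K : nzRingType) (R : comNzRingType) (f : {rmorphism K -> R}) n
    (a : 'I_n.+1 -> R) (p : {mpoly K[n.+1]}) :
  mmap f a p =
  (map_poly (mmap f (a \o widen_ord (leqnSn n))) (muni p)).[a ord_max].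
Proof.
rewrite muniE rmorph_sum horner_sum.
apply: eq_bigr => u _; rewrite -mul_polyC rmorphM /= map_polyC map_polyXn.
rewrite hornerM hornerC hornerXn /= mmapZ mmapX -mulrA; congr (_ * _).
rewrite /mmap1 big_ord_recr /=; congr (_ * _).
by apply: eq_bigr => i _; rewrite mnmE.
Qed.

(** Induction on the number of variables.  Specialize all variables but the last
    one, keeping the coefficient of the highest power [d] of the last one
    nonzero: the polynomial in one variable thus obtained has degree [d], so it
    does not vanish at all of the [d + 1] values [v 0, ..., v d] that are taken
    most often.  If [v j] is not a root, the multiplicities change as if the
    letter [r <= j <= d] were appended to the lattice word, where [r] is the first
    row of the same length as row [j]. *)
Lemma nonvanishing_point (K : fieldType) (R : idomainType)
    (f : {rmorphism K -> R}) (v0 : nat -> R) n (p : {mpoly K[n]}) :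
  injective v0 -> p != 0 ->
  exists m e (a : 'I_n -> R) (v : nat -> R),
    [/\ m \in msupp p, all2 leq e (m : 'X_{1..n}), lattice_word e, injective v
      & (forall r, \sum_(i < n) (a i == v r) = mult r e)%N /\ mmap f a p != 0].
Proof.
move=> v0_inj; elim: n p => [|n IH] p nz.
  have pE : p = (p@_0%MM)%:MP.
    apply/mpolyP => m; rewrite mcoeffC.
    have -> : m = 0%MM by apply/mnmP => -[].
    by rewrite eqxx mulr1.
  have c0 : p@_0%MM != 0 by apply: contra nz => /eqP c; rewrite pE c mpolyC0.
  exists 0%MM, [::], (fun=> 0), v0; split=> //.
  - by rewrite mcoeff_msupp.
  - by apply/all2_leqP; split=> [|i]; rewrite ?size_tuple ?nth_nil.
  - by split=> [r|]; [rewrite big_ord0 | rewrite pE mmapC fmorph_eq0].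
pose q := muni p.
have q_nz : q != 0.
  apply: contra nz => /eqP q0; apply/eqP/mpolyP => m.
  have -> : m = mnm_rcons [multinom m (widen_ord (leqnSn n) i) | i < n]
                          (m ord_max).
    apply/mnmP => i; case: (unliftP ord_max i) => [j ->|->].
      have -> : lift ord_max j = widen_ord (leqnSn n) j.
        by apply: val_inj; rewrite /= /bump leqNgt ltn_ord.
      by rewrite mnm_rcons_widen mnmE.
    by rewrite mnm_rcons_max.
  by rewrite -mcoeff_muni -/q q0 coef0 !mcoeff0.
pose d := (size q).-1.
have lq : lead_coef q != 0 by rewrite lead_coef_eq0.
have [m [e [a [v [mp em He v_inj [cnt nzg]]]]]] := IH _ lq.
pose h := map_poly (mmap f a) q.
have h_nz : h != 0.
  apply/eqP => h0; move/eqP: nzg; apply.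
  have := congr1 (fun g : {poly R} => g`_d) h0.
  by rewrite coef_map coef0.
have szh : (size h <= d.+1)%N.
  by rewrite (leq_trans (size_poly _ _)) // /d prednK // lt0n size_poly_eq0.
have [j jd hj] : exists2 j, (j <= d)%N & ~~ root h (v j).
  have : ~~ all (root h) [seq v j | j <- iota 0 d.+1].
    apply/negP => /(max_poly_roots h_nz) /(_ _).
    rewrite map_inj_uniq // iota_uniq size_map size_iota ltnNge szh.
    by move/(_ isT).
  rewrite all_map -has_predC => /hasP [j]; rewrite mem_iota => jd hj.
  by exists j.
have ex_r : exists r, mult r e == mult j e by exists j.
case: (ex_minnP ex_r) => r /eqP rj rmin.
have rlej : (r <= j)%N by apply: rmin.
(* Rows [r] and [j] have the same length: after exchanging their values, the one
   that gains a point is attached to [r]. *)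
pose sw s := if s == r then j else if s == j then r else s.
have swK : involutive sw.
  move=> s; rewrite /sw; have [->|sr] := eqVneq s r.
    by rewrite eqxx; case: eqP.
  have [->|sj] := eqVneq s j; first by rewrite eqxx.
  by rewrite (negbTE sr) (negbTE sj).
exists (mnm_rcons m d), (rcons e r).
exists (fun i => if unlift ord_max i is Some i' then a i' else v j), (v \o sw).
have widenE (i : 'I_n) : unlift ord_max (widen_ord (leqnSn n) i) = Some i.
  have -> : widen_ord (leqnSn n) i = lift ord_max i.
    by apply: val_inj; rewrite /= /bump leqNgt ltn_ord.
  by rewrite liftK.
split.
- by rewrite mcoeff_msupp -mcoeff_muni -mcoeff_msupp.
- by apply: all2_leq_rcons; rewrite // (leq_trans rlej).
- apply/lattice_word_rcons; split=> // s rs.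
  rewrite -rs ltn_neqAle [in X in _ && X]rs lattice_wordW // andbT.
  by apply/eqP => eq; have := rmin s; rewrite -eq rj eqxx rs ltnn => /(_ isT).
- exact: inj_comp v_inj (inv_inj swK).
split=> [s|].
  rewrite big_ord_recr /= unlift_none (inj_eq v_inj).
  under eq_bigr => i _ do rewrite widenE.
  rewrite cnt mult_rcons /sw; have [->|sr] := eqVneq s r.
    by rewrite !eqxx rj.
  have [sj|sj] := eqVneq s j; last by rewrite eq_sym (negbTE sj).
  by rewrite rj -sj (negbTE sr).
rewrite mmap_muni unlift_none; apply: contra hj; rewrite /root.
congr (_.[_] == 0); apply/polyP => k; rewrite !coef_map /=.
by apply: eq_bigr => u _; congr (_ * _); apply: mmap1_eq => i; rewrite /= widenE.
Qed.

(** * Specht polynomials of colorings *)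

Lemma ideal_gen_incl (R : comNzRingType) (G : set R) g : G g -> ideal_gen G g.
Proof.
move=> Gg; exists [:: (1, g)]; split=> [u|].
  by rewrite inE => /eqP ->.
by rewrite big_seq1 mul1r.
Qed.

Lemma ideal_gen0 (R : comNzRingType) (G : set R) : ideal_gen G 0.
Proof. by exists [::]; split=> //; rewrite big_nil. Qed.

Lemma ideal_genD (R : comNzRingType) (G : set R) p q :
  ideal_gen G p -> ideal_gen G q -> ideal_gen G (p + q).
Proof.
move=> [s [Gs ->]] [t [Gt ->]]; exists (s ++ t); split; last by rewrite big_cat.
by move=> u; rewrite mem_cat => /orP[/Gs|/Gt].
Qed.

Lemma ideal_genMl (R : comNzRingType) (G : set R) c p :
  ideal_gen G p -> ideal_gen G (c * p).
Proof.
move=> [s [Gs ->]]; exists [seq (c * u.1, u.2) | u <- s]; split.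
  by move=> u /mapP [w /Gs Gw ->].
by rewrite big_map mulr_sumr; apply: eq_bigr => u _; rewrite mulrA.
Qed.

Lemma ideal_genB (R : comNzRingType) (G : set R) p q :
  ideal_gen G p -> ideal_gen G q -> ideal_gen G (p - q).
Proof.
by move=> Ip Iq; apply: ideal_genD => //; rewrite -mulN1r; apply: ideal_genMl.
Qed.

Lemma ideal_gen_sum (R : comNzRingType) (G : set R) (I : Type) (r : seq I)
    (P : pred I) (F : I -> R) :
  (forall i, P i -> ideal_gen G (F i)) -> ideal_gen G (\sum_(i <- r | P i) F i).
Proof.
move=> H; elim/big_rec: _ => [|i p Pi Ip]; first exact: ideal_gen0.
by apply: ideal_genD => //; apply: H.
Qed.

Lemma size_prod_XsubC_in (R : fieldType) (I : finType) (A : {pred I})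
    (z : I -> R) : size (\prod_(i in A) ('X - (z i)%:P)) = #|A|.+1.
Proof. by rewrite -big_enum size_prod_XsubC -cardE. Qed.

(** Comparison of the leading coefficients in Lagrange's interpolation formula. *)
Lemma lagrange_lead (F : fieldType) (I : finType) (A : {pred I}) (z : I -> F)
    (Q : {poly F}) :
  {in A &, injective z} -> Q \is monic -> size Q = #|A| ->
  \sum_(i in A) Q.[z i] / \prod_(j in A | j != i) (z i - z j) = 1.
Proof.
move=> z_inj Q_monic szQ.
pose L i := \prod_(j in A | j != i) ('X - (z j)%:P).
pose w i := \prod_(j in A | j != i) (z i - z j).
have wE i : (L i).[z i] = w i.
  rewrite horner_prod; apply: eq_bigr => j _.
  by rewrite hornerXsubC.
have w_nz i : i \in A -> w i != 0.
  move=> iA; apply/prodf_neq0 => j /andP[jA ji]; rewrite subr_eq0.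
  by apply: contra ji => /eqP /z_inj ->.
have L0 i j : i \in A -> j \in A -> j != i -> (L i).[z j] = 0.
  move=> iA jA ji; rewrite horner_prod (bigD1 j) ?jA //= hornerXsubC subrr.
  by rewrite mul0r.
have szL i : i \in A -> size (L i) = #|A|.
  move=> iA; rewrite (cardD1 i) iA add1n -(size_prod_XsubC_in _ z).
  congr (size (polyseq _)).
  by rewrite /L; apply: eq_bigl => j; rewrite !inE andbC.
have QE : Q = \sum_(i in A) (Q.[z i] / w i) *: L i.
  apply/eqP; rewrite -subr_eq0; apply/eqP; set D := _ - _.
  apply/eqP; apply/negPn/negP => D_nz.
  have := max_poly_roots (rs := [seq z i | i <- enum A]) D_nz.
  rewrite map_inj_in_uniq ?enum_uniq; last first.
    by move=> i j; rewrite !mem_enum; apply: z_inj.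
  have -> : all (root D) [seq z i | i <- enum A].
    apply/allP => _ /mapP [i iA ->]; rewrite mem_enum in iA.
    rewrite /root /D hornerD hornerN horner_sum (bigD1 i) //= big1 => [|j /andP[jA ji]].
      by rewrite addr0 hornerZ wE divfK ?w_nz // subrr.
    by rewrite hornerZ L0 ?mulr0 // eq_sym.
  move=> /(_ isT isT); rewrite size_map -cardE ltnNge => /negP; apply.
  rewrite (leq_trans (size_polyD _ _)) // geq_max szQ leqnn size_polyN /=.
  apply: (leq_trans (size_sum _ _ _)); apply/bigmax_leqP => i iA.
  by rewrite (leq_trans (size_scale_leq _ _)) // szL.
have : lead_coef Q = 1 by apply/eqP.
rewrite lead_coefE szQ {1}QE coef_sum; apply: etrans.
apply: eq_bigr => i iA; rewrite coefZ -(szL i iA) -lead_coefE.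
have /eqP -> : L i \is monic by apply: monic_prod_XsubC.
by rewrite mulr1.
Qed.

(** Up to sign, the product of the Vandermonde determinants of the color
    classes of [k]: for a tableau [T], the Specht polynomial of [T] if the color of
    an entry is its column. *)
Definition color_poly (K : fieldType) n (k : 'I_n -> nat) : {mpoly K[n]} :=
  \prod_(p : 'I_n * 'I_n | (p.1 < p.2)%N && (k p.1 == k p.2)) ('X_p.1 - 'X_p.2).
Arguments color_poly K {n} k.

(** The sign collects the factors ['X_j - 'X_x] with [j < x]. *)
Lemma color_poly_split (K : fieldType) n (k : 'I_n -> nat) (x : 'I_n) :
  exists2 s : {mpoly K[n]}, s * s = 1 &
  color_poly K k = s *
    \prod_(p : 'I_n * 'I_n | [&& (p.1 < p.2)%N, k p.1 == k p.2, p.1 != x & p.2 != x])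
        ('X_p.1 - 'X_p.2)
    * \prod_(j < n | (j != x) && (k j == k x)) ('X_x - 'X_j).
Proof.
exists (\prod_(j < n | (j != x) && (k j == k x)) (-1) ^+ (j < x)%N).
  rewrite -big_split /= big1 // => j _.
  by rewrite -expr2 sqrr_sign.
rewrite /color_poly (bigID (fun p : 'I_n * 'I_n => (p.1 != x) && (p.2 != x))) /=.
rewrite mulrAC mulrC; congr (_ * _); last first.
  by apply: eq_bigl => p; rewrite -andbA.
rewrite -big_split /=.
pose h (j : 'I_n) : 'I_n * 'I_n := if (x < j)%N then (x, j) else (j, x).
rewrite (reindex_onto h (fun p => if p.1 == x then p.2 else p.1)) /=; last first.
  move=> [i j] /= /andP[/andP[ij kij]].
  rewrite negb_and !negbK /h; case: (i =P x) => [ix|ix] /=; first by rewrite -ix ij.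
  by move/eqP => jx; rewrite -jx ltnNge (ltnW ij).
have hx j : (if (h j).1 == x then (h j).2 else (h j).1) = j.
  by rewrite /h; case: (ltnP x j) => /= _; [rewrite eqxx | case: (eqVneq j x)].
apply: eq_big => [j|j /andP[/andP[/andP[hj kj] _] _]].
  rewrite hx eqxx andbT /h; case: (ltngtP x j) => /= [xj|jx|/val_inj xj].
  - have -> : j != x by apply: contraL xj => /eqP ->; rewrite ltnn.
    by rewrite xj eqxx /= andbT eq_sym.
  - have -> : j != x by apply: contraL jx => /eqP ->; rewrite ltnn.
    by rewrite jx eqxx /= andbT.
  - by rewrite xj ltnn !eqxx.
move: hj; rewrite /h; case: (ltngtP x j) => /= xj hj'.
- by rewrite mul1r.
- by rewrite expr1 mulN1r opprB.
- by rewrite xj ltnn in hj'.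
Qed.

Definition recolor n (k : 'I_n -> nat) (b : nat) (x : 'I_n) : 'I_n -> nat :=
  fun i => if i == x then b else k i.

(** Multiply Lagrange's formula, for the values at the points of color [a] of a
    monic polynomial of degree [#|a| - 1] that vanishes at the points of color [b],
    by [color_poly k]. *)
Lemma color_poly_recolor (K : fieldType) n (k : 'I_n -> nat) (a b : nat) : a != b ->
  (#|[pred i | k i == b]| < #|[pred i | k i == a]|)%N ->
  exists c : 'I_n -> {mpoly K[n]},
    color_poly K k = \sum_(x < n | k x == a) c x * color_poly K (recolor k b x).
Proof.
move=> ab lt; pose t := @tofrac {mpoly K[n]}.
pose A := [pred i | k i == a]; pose B := [pred i | k i == b].
pose e := (#|A| - #|B|.+1)%N.
pose Q : {poly {fraction {mpoly K[n]}}} :=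
  'X^e * \prod_(j in B) ('X - (t 'X_j)%:P).
have Qmon : Q \is monic by rewrite monicMl ?monicXn // monic_prod_XsubC.
have X_inj : injective (fun i : 'I_n => t 'X_i).
  move=> i j /eqP; rewrite tofrac_eq => /eqP /(congr1 (mcoeff U_(i))).
  rewrite !mcoeffXU eqxx => /eqP; case: (j =P i) => // _.
  by rewrite /= oner_eq0.
have szQ : size Q = #|A|.
  rewrite size_monicM ?monicXn ?monic_neq0 ?monic_prod_XsubC //.
  by rewrite size_polyXn size_prod_XsubC_in /e addSn subnK.
have := lagrange_lead (fun i j _ _ => @X_inj i j) Qmon szQ.
pose rest (k' : 'I_n -> nat) x : {mpoly K[n]} := \prod_(p : 'I_n * 'I_n |
  [&& (p.1 < p.2)%N, k' p.1 == k' p.2, p.1 != x & p.2 != x]) ('X_p.1 - 'X_p.2).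
pose V (k' : 'I_n -> nat) x : {mpoly K[n]} :=
  \prod_(j < n | (j != x) && (k' j == k' x)) ('X_x - 'X_j).
pose s (k' : 'I_n -> nat) x := s2val (cid2 (color_poly_split K k' x)).
have ss k' x : s k' x * s k' x = 1 by rewrite /s; case: cid2.
have sE k' x : color_poly K k' = s k' x * rest k' x * V k' x.
  by rewrite /s; case: cid2.
move=> lag; exists (fun x => s k x * s (recolor k b x) x * 'X_x ^+ e).
apply/eqP; rewrite -tofrac_eq rmorph_sum /= -/t -[t _]mulr1 -[X in _ * X]lag.
rewrite mulr_sumr; apply/eqP; apply: eq_bigr => x xa.
have kx : k x = a by apply/eqP.
have restE : rest (recolor k b x) x = rest k x.
  apply: eq_bigl => p; rewrite /recolor; case: (_ < _)%N => //=.
  by case: (p.1 == x) => //=; rewrite ?andbF //; case: (p.2 == x); rewrite ?andbF.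
have VE : \prod_(j in A | j != x) (t 'X_x - t 'X_j) = t (V k x).
  rewrite /t rmorph_prod; apply: eq_big => [j|j _]; last by rewrite rmorphB.
  by rewrite !inE kx andbC.
have V_nz : t (V k x) != 0.
  rewrite -VE; apply/prodf_neq0 => j /andP[_ jx]; rewrite subr_eq0.
  by apply: contra jx => /eqP /X_inj ->.
have QE : Q.[t 'X_x] = t ('X_x ^+ e * V (recolor k b x) x).
  rewrite /Q hornerM hornerXn horner_prod /t rmorphM rmorphXn rmorph_prod.
  congr (_ * _); apply: eq_big => [j|j _]; last by rewrite hornerXsubC rmorphB.
  rewrite /recolor eqxx !inE; case: (j =P x) => //= ->.
  by rewrite kx; apply/negbTE.
rewrite VE QE (sE k x) [color_poly K (recolor _ _ _)](sE _ x) restE.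
have tM u v : t (u * v) = t u * t v by rewrite /t rmorphM.
rewrite [t (_ * V k x)]tM [LHS]mulrA [X in X / _]mulrAC mulfK // -tM; congr t.
transitivity (s k x * (s (recolor k b x) x * s (recolor k b x) x) *
              rest k x * 'X_x ^+ e * V (recolor k b x) x).
  by rewrite ss mulr1 mulrA.
by ring.
Qed.

Local Close Scope ring_scope.

Definition num_lt_color n (k : 'I_n -> nat) (c : nat) : nat :=
  \sum_(i < n) (k i < c).

Definition color_size n (k : 'I_n -> nat) (c : nat) : nat :=
  #|[pred i | k i == c]|.

Lemma num_lt_colorS n (k : 'I_n -> nat) c :
  num_lt_color k c.+1 = num_lt_color k c + color_size k c.
Proof.
rewrite /color_size -sum1_card [X in _ = _ + X]big_mkcond -big_split /=.
by apply: eq_bigr => i _; rewrite inE; case: ifP; lia.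
Qed.

Lemma num_lt_color_le n (k : 'I_n -> nat) c : num_lt_color k c <= n.
Proof.
rewrite -{2}(card_ord n) -sum1_card; apply: leq_sum => i _; exact: leq_b1.
Qed.

Lemma box_eq la (b b' : box la) :
  box_row b = box_row b' -> box_col b = box_col b' -> b = b'.
Proof.
case: b b' => [r c] [r' c']; rewrite /box_row /box_col /= => /val_inj rr'.
by move: c'; rewrite -rr' => c' /val_inj ->.
Qed.

Lemma card_box la : #|box la| = sumn la.
Proof.
rewrite card_tagged !sumnE big_map big_enum /= [RHS](big_nth 0) big_mkord.
by apply: eq_bigr => r _; rewrite card_ord.
Qed.

(** Filling column [c], from top to bottom, with the increasing list of the
    variables of color [c] makes the row order agree with the order of the
    variables, so that no sign appears. *)
Lemma color_poly_specht (K : fieldType) n la (k : 'I_n -> nat) : 0 < n ->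
  (forall r, nth 0 la r.+1 <= nth 0 la r) -> sumn la = n ->
  (forall c, color_size k c = count (fun l => c < l) la) ->
  specht_ideal K n la (color_poly K k).
Proof.
move=> n_gt0 la_anti la_sum sz.
pose L c := enum [pred i | k i == c].
pose T (b : box la) : 'I_n := nth (Ordinal n_gt0) (L (box_col b)) (box_row b).
have rowP (b : box la) : box_row b < size (L (box_col b)).
  rewrite -cardE -/(color_size _ _) sz; apply: row_lt_col_height => //.
  by rewrite /box_row /box_col; case: b => r c /=; apply: ltn_ord.
have kT b : k (T b) = box_col b.
  by have := mem_nth (Ordinal n_gt0) (rowP b); rewrite mem_enum inE => /eqP.
have Linc c : sorted ltn [seq val i | i <- L c].
  have -> : [seq val i | i <- L c] = [seq val i | i <- enum 'I_n & k i == c].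
    by rewrite /L enumT; congr map; apply: eq_filter => i; rewrite inE.
  apply: (subseq_sorted ltn_trans (map_subseq _ (filter_subseq _ _))).
  by rewrite val_enum_ord iota_ltn_sorted.
have T_lt b b' : box_col b = box_col b' -> (T b < T b') = (box_row b < box_row b').
  move=> bb'; have := rowP b; have := rowP b'; rewrite /T -bb'.
  set l := L _ => s' s.
  have lt r r' : r < size l -> r' < size l -> r < r' ->
      nth (Ordinal n_gt0) l r < nth (Ordinal n_gt0) l r'.
    move=> rs rs' rr'; have := sorted_ltn_nth ltn_trans 0 (Linc (box_col b)).
    move=> /(_ r r'); rewrite !inE size_map => /(_ rs rs' rr').
    by rewrite !(nth_map (Ordinal n_gt0)).
  case: (ltngtP (box_row b) (box_row b')) => rr'; first exact: lt.
    by apply/negbTE; rewrite -leqNgt ltnW // lt.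
  by rewrite rr' ltnn.
have T_inj : injective T.
  move=> b b' TT; have cc : box_col b = box_col b' by rewrite -!kT TT.
  apply: box_eq => //; apply/eqP; rewrite eqn_leq.
  by apply/andP; split; rewrite leqNgt -T_lt // TT ltnn.
have T_bij : bijective T.
  by apply: inj_card_bij => //; rewrite card_box la_sum card_ord.
apply: ideal_gen_incl; exists T => //.
rewrite /specht_poly pair_big_dep /=.
case: T_bij => T' TK TK'.
rewrite /color_poly (reindex (fun p : box la * box la => (T p.1, T p.2))) /=.
  apply: eq_bigl => -[b b'] /=; rewrite !kT andbC.
  by case: (box_col b =P box_col b') => //= /T_lt ->.
by exists (fun p => (T' p.1, T' p.2)) => -[i j] _ /=; rewrite ?TK ?TK'.
Qed.

(** As long as the colors are not distributed like the columns of [la], take the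
    first excess [j], and the first color [j'] after which the excess has been
    compensated; moving a variable from color [j] to [j'] brings the distribution
    closer to that of [la], and [color_poly_recolor] applies. *)
Lemma color_poly_in_specht (K : fieldType) n la (k : 'I_n -> nat) : 0 < n ->
  (forall r, nth 0 la r.+1 <= nth 0 la r) -> sumn la = n ->
  (forall c, num_boxes la c <= num_lt_color k c) ->
  specht_ideal K n la (color_poly K k).
Proof.
move=> n_gt0 la_anti la_sum.
pose L := head 0 la.
have [N] := ubnP (\sum_(i < n) (L - k i)).
elim: N k => // N IH k ltN dom.
have kL i : k i < L.
  rewrite ltnNge; apply/negP => Li.
  have := dom L; rewrite num_boxes_max // la_sum leqNgt => /negP; apply.
  rewrite -{2}(card_ord n) -sum1_card /num_lt_color.
  rewrite (bigD1 i) //= [X in _ < X](bigD1 i) //= [k i < L]ltnNge Li /=.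
  rewrite add0n add1n ltnS.
  by apply: leq_sum => j _; apply: leq_b1.
have [ex|all_eq] := boolP [exists c : 'I_L.+1, num_boxes la c < num_lt_color k c];
  last first.
  have E c : num_lt_color k c = num_boxes la c.
    apply/eqP; rewrite eqn_leq dom andbT.
    case: (ltnP c L.+1) => cL.
      by move/existsPn: all_eq => /(_ (Ordinal cL)); rewrite -leqNgt.
    by rewrite num_boxes_max ?(ltnW cL) // la_sum num_lt_color_le.
  apply: color_poly_specht => // c.
  by have := E c.+1; rewrite num_lt_colorS num_boxesS E => /addnI.
have {ex} ex : exists c, num_boxes la c < num_lt_color k c.
  by case/existsP: ex => c; exists c.
have [[|j] jlt jmin] := ex_minnP ex.
  by move: jlt; rewrite /num_lt_color big1.
have ex' : exists d, (j.+1 < d) && (num_lt_color k d == num_boxes la d).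
  exists (L + j).+2; rewrite !ltnS leq_addl /=.
  by rewrite eqn_leq dom andbT num_boxes_max ?la_sum ?num_lt_color_le //; lia.
have [[//|j'] /andP[jj' /eqP eqd] dmin] := ex_minnP ex'.
have eqj : num_lt_color k j = num_boxes la j.
  apply/eqP; rewrite eqn_leq dom andbT leqNgt; apply/negP => /jmin.
  by rewrite ltnn.
have mid c : j < c <= j' -> num_boxes la c < num_lt_color k c.
  move=> /andP[jc cj']; move: jc; rewrite leq_eqVlt => /orP[/eqP <- //|jc].
  rewrite ltn_neqAle dom andbT; apply/eqP => eqc.
  by have := dmin c; rewrite jc -eqc eqxx => /(_ isT); lia.
have szj : count (fun l => j < l) la < color_size k j.
  by move: jlt; rewrite num_lt_colorS num_boxesS eqj; lia.
have szj' : color_size k j' < count (fun l => j' < l) la.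
  by have := mid j'; move: eqd; rewrite num_lt_colorS num_boxesS; lia.
have col_anti : count (fun l => j' < l) la <= count (fun l => j < l) la.
  by apply: sub_count => l /=; lia.
have [||c ->] := @color_poly_recolor K n k j j'.
- by lia.
- by rewrite -!/(color_size _ _); lia.
apply: ideal_gen_sum => x /eqP kx; apply: ideal_genMl; apply: IH.
  rewrite (leq_trans _ (ltnSE ltN)) // (bigD1 x) //= [X in _ < X](bigD1 x) //=.
  rewrite -addSn leq_add //.
    by rewrite /recolor eqxx kx; have := kL x; rewrite kx; lia.
  by apply: leq_sum => i ix; rewrite /recolor (negbTE ix).
move=> d.
have E : num_lt_color k d = num_lt_color (recolor k j' x) d + (j < d <= j').
  rewrite /num_lt_color (bigD1 x) //= [X in _ = X + _](bigD1 x) //=.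
  rewrite /recolor eqxx kx addnAC; congr (_ + _); first by lia.
  by apply: eq_bigr => i ix; rewrite (negbTE ix).
by have := dom d; have := mid d; lia.
Qed.

(** * Evaluation of Specht polynomials *)

Local Open Scope ring_scope.

Lemma leq_card_in (T T' : finType) (A : {pred T}) (B : {pred T'}) (f : T -> T') :
  {in A &, injective f} -> {in A, forall x, f x \in B} -> (#|A| <= #|B|)%N.
Proof.
move=> f_inj AB; rewrite -(card_in_image f_inj); apply: subset_leq_card.
by apply/fintype.subsetP => _ /fintype.imageP [x xA ->]; apply: AB.
Qed.

(** In each column the values of [a] are distinct, so that [r] given values occur
    there at most [r] times; hence they occur altogether at most as often as there
    are boxes in the first [r] rows. *)
Lemma specht_nonvanishing_dominated (K : fieldType) (R : idomainType)
    (f : {rmorphism K -> R}) n la (T : box la -> 'I_n) (a : 'I_n -> R)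
    (v : nat -> R) (e : seq nat) :
  (forall r, nth 0 la r.+1 <= nth 0 la r)%N -> bijective T -> injective v ->
  (forall r, \sum_(i < n) (a i == v r) = mult r e)%N ->
  mmap f a (specht_poly K T) != 0 -> dominated la e.
Proof.
move=> la_anti T_bij v_inj cnt nz [|r]; first by rewrite num_ltE big_ord0.
have aT b b' : box_col b = box_col b' -> a (T b) = a (T b') ->
    box_row b = box_row b'.
  wlog lt : b b' / (box_row b < box_row b')%N => [H cc aa|cc aa].
    case: (ltngtP (box_row b) (box_row b')) => // [lt|gt]; first exact: H.
    by apply/esym; apply: H.
  move: nz; rewrite /specht_poly rmorph_prod => /prodf_neq0 /(_ b isT).
  rewrite rmorph_prod => /prodf_neq0 /(_ b'); rewrite cc eqxx lt => /(_ isT).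
  by rewrite rmorphB /= !mmapX !mmap1U aa subrr eqxx.
have la_antile s t : (s <= t)%N -> (nth 0 la t <= nth 0 la s)%N.
  move=> /subnK <-; elim: (t - s)%N => // d; rewrite addSn.
  exact: leq_trans (la_anti _).
pose row_of i : 'I_r.+1 := odflt ord0 [pick s : 'I_r.+1 | a i == v s].
pose A := [pred b : box la | [exists s : 'I_r.+1, a (T b) == v s]].
have row_ofP b : b \in A -> a (T b) = v (row_of (T b)).
  rewrite inE /row_of => /existsP [s Hs]; case: pickP => [t /eqP //|].
  by move/(_ s); rewrite Hs.
pose L := head 0%N la.
have colL (b : box la) : (box_col b < L)%N.
  apply: leq_trans (la_antile 0 (box_row b) _) => //.
  by rewrite /box_row /box_col; case: b => s c /=; apply: ltn_ord.
have -> : num_lt r.+1 e = #|A|.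
  rewrite num_ltE; under eq_bigr => s _ do rewrite -cnt.
  rewrite exchange_big /= (reindex T) /=; last exact: onW_bij.
  rewrite -sum1_card [RHS]big_mkcond; apply: eq_bigr => b _.
  rewrite inE; case: ifP => [/existsP [s /eqP bs]|/negbT/existsPn no].
    rewrite (bigD1 s) //= bs eqxx big1 // => t ts.
    by rewrite (inj_eq v_inj) val_eqE eq_sym (negbTE ts).
  by rewrite big1 // => s _; rewrite (negbTE (no s)).
have -> : sumn (take r.+1 la) = (\sum_(c < L) \sum_(s < r.+1) (c < nth 0 la s))%N.
  rewrite exchange_big /=.
  transitivity (\sum_(s < r.+1) nth 0 la s)%N.
    elim: (r.+1) => [|t IH]; first by rewrite take0 big_ord0.
    by rewrite sumn_takeS big_ord_recr IH.
  apply: eq_bigr => s _; have := la_antile 0 s isT; rewrite nth0 -/L.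
  move: (nth _ _ _) => x; move=> xL.
  rewrite -[LHS]card_ord -sum1_card (big_ord_widen _ (fun=> 1%N) xL) big_mkcond.
  by apply: eq_bigr => c _; case: ltnP.
rewrite -sum1_card (partition_big (fun b => Ordinal (colL b)) predT) //=.
apply: leq_sum => c _.
have -> : (\sum_(s < r.+1) (c < nth 0 la s) =
           #|[pred s : 'I_r.+1 | c < nth 0 la s]|)%N.
  rewrite -sum1_card [RHS]big_mkcond; apply: eq_bigr => s _.
  by rewrite inE; case: ltnP.
rewrite sum1dep_card.
have colE b : Ordinal (colL b) = c -> box_col b = c by move=> <-.
have [cr|rc] := ltnP c (nth 0%N la r).
  apply: (@leq_card_in _ _ _ _ (fun b => row_of (T b))) => [b b'|b].
    rewrite !inE => /andP[bA /eqP/colE bc] /andP[bA' /eqP/colE bc'] ss'.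
    apply: box_eq; last by rewrite bc bc'.
    apply: aT; first by rewrite bc bc'.
    by rewrite !row_ofP // ss'.
  rewrite !inE => _; apply: leq_trans cr _; apply: la_antile.
  by rewrite -ltnS ltn_ord.
have colrow (b : box la) : box_col b = c -> (c < nth 0 la (box_row b))%N.
  by move=> <-; rewrite /box_row /box_col; case: b => s d /=; apply: ltn_ord.
have rowr (b : box la) : box_col b = c -> (box_row b < r.+1)%N.
  move=> /colrow cb; rewrite ltnNge; apply/negP => /ltnW /la_antile.
  by move: cb rc; clear; lia.
apply: (@leq_card_in _ _ _ _ (fun b => inord (box_row b))) => [b b'|b].
  rewrite !inE => /andP[_ /eqP/colE bc] /andP[_ /eqP/colE bc'] /(congr1 val).
  rewrite /= !inordK ?rowr // => rr'.
  by apply: box_eq => //; rewrite bc bc'.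
by rewrite !inE => /andP[_ /eqP/colE bc]; rewrite inordK ?rowr // colrow.
Qed.

(** * Initial ideals for increasing variables *)

(** The points are taken over [K[t]], which is infinite even if [K] is finite. *)
Lemma specht_ideal_support (K : fieldType) n la (p : {mpoly K[n]}) :
  (forall r, nth 0 la r.+1 <= nth 0 la r)%N ->
  specht_ideal K n la p -> p != 0 ->
  exists2 m, m \in msupp p & init_word la (m : 'X_{1..n}).
Proof.
move=> la_anti [s [Gs pE]] p_nz.
have X_inj : injective (fun r => 'X^r : {poly K}).
  by move=> r t /(congr1 (fun q : {poly K} => size q)); rewrite !size_polyXn => -[].
have [m [e [a [v [mp em He v_inj [cnt nz]]]]]] :=
  nonvanishing_point (polyC : {rmorphism K -> {poly K}}) X_inj p_nz.
exists m => //; exists e; split=> //.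
have [u us nzu] : exists2 u, u \in s & mmap polyC a u.2 != 0.
  apply: contrapT => no; move/eqP: nz; apply.
  rewrite pE rmorph_sum big_seq big1 // => u us; rewrite rmorphM /=.
  have [->|nzu] := eqVneq (mmap polyC a u.2) 0; first by rewrite mulr0.
  by case: no; exists u.
have [T T_bij uT] := Gs u us; rewrite uT in nzu.
exact: (specht_nonvanishing_dominated la_anti T_bij v_inj cnt nzu).
Qed.

(** The polynomials by which others are reduced are homogeneous, so that reductions
    stay within finitely many monomials. *)
Definition lead_homog (K : fieldType) n (le : rel 'X_{1..n}) (p : {mpoly K[n]})
    (m : 'X_{1..n}) : Prop :=
  m \in msupp p /\ forall m', m' \in msupp p -> le m' m /\ mdeg m' = mdeg m.

Lemma monomial_order_addl n (le : rel 'X_{1..n}) (u m1 m2 : 'X_{1..n}) :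
  monomial_order le -> le m1 m2 -> le (u + m1)%MM (u + m2)%MM.
Proof.
by move=> Hle /(monomial_order_add Hle u); rewrite ![(_ + u)%MM]addmC.
Qed.

Lemma lead_homogX (K : fieldType) n (le : rel 'X_{1..n}) m :
  monomial_order le -> lead_homog le ('X_[m] : {mpoly K[n]}) m.
Proof.
move=> Hle; split; first by rewrite msuppX inE.
move=> m'; rewrite msuppX inE => /eqP ->; split=> //.
exact: monomial_order_refl Hle _.
Qed.

Lemma lead_homogM (K : fieldType) n (le : rel 'X_{1..n}) (p q : {mpoly K[n]})
    mp mq : monomial_order le ->
  lead_homog le p mp -> lead_homog le q mq -> lead_homog le (p * q) (mp + mq)%MM.
Proof.
move=> Hle [pm Hp] [qm Hq]; split; last first.
  move=> m /msuppM_le /allpairsP [[m1 m2] /= [/Hp [l1 d1] /Hq [l2 d2] ->]].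
  split; last by rewrite !mdegD d1 d2.
  apply: (monomial_order_trans Hle (y := (mp + m2)%MM)).
    exact: (monomial_order_add Hle).
  exact: monomial_order_addl Hle l2.
rewrite mcoeff_msupp mpolyME raddf_sum /=.
rewrite (bigD1_seq (mp, mq)) /=; last first.
- by apply: allpairs_uniq; rewrite ?msupp_uniq // => -[? ?] [? ?].
- by apply/allpairsP; exists (mp, mq).
rewrite mcoeffZ mcoeffX eqxx mulr1 big_seq_cond big1.
  by rewrite addr0 mulf_neq0 // -mcoeff_msupp.
move=> [m1 m2] /= /andP[/allpairsP [[u1 u2] /= [/Hp [l1 _] /Hq [l2 _] [-> ->]]] ne].
rewrite mcoeffZ mcoeffX; case: eqP => [E|_]; last by rewrite mulr0.
(* Both summands are at most the leading ones, so neither can be smaller. *)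
case/eqP: ne; have E1 : (u1 + mq)%MM = (mp + mq)%MM.
  apply: (monomial_order_anti Hle); rewrite (monomial_order_add Hle) //=.
  by rewrite -E; apply: monomial_order_addl Hle l2.
by rewrite (addIm E1) in E *; rewrite (addmI E).
Qed.

Lemma lead_homog_prod (K : fieldType) n (le : rel 'X_{1..n}) (I : Type)
    (r : seq I) (P : pred I) (F : I -> {mpoly K[n]}) (m : I -> 'X_{1..n}) :
  monomial_order le -> (forall i, P i -> lead_homog le (F i) (m i)) ->
  lead_homog le (\prod_(i <- r | P i) F i) (\big[mnm_add/mnm0]_(i <- r | P i) m i).
Proof.
move=> Hle FP; elim/big_rec2: _ => [|i m' p Pi IH].
  by rewrite -mpolyX0; apply: lead_homogX.
by apply: lead_homogM => //; apply: FP.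
Qed.

Definition increasing_vars n (le : rel 'X_{1..n}) : Prop :=
  forall i j : 'I_n, (i < j)%N -> le U_(i)%MM U_(j)%MM.

(** The leading monomial of ['X_i - 'X_j] is ['X_j] if [i < j]. *)
Lemma lead_homog_color_poly (K : fieldType) n (le : rel 'X_{1..n})
    (k : 'I_n -> nat) (m : 'X_{1..n}) :
  monomial_order le -> increasing_vars le ->
  (forall j, m j = \sum_(i < n) ((i < j) && (k i == k j)))%N ->
  lead_homog le (color_poly K k) m.
Proof.
move=> Hle inc mE.
have -> : m = \big[mnm_add/mnm0]_(p : 'I_n * 'I_n |
                 (p.1 < p.2)%N && (k p.1 == k p.2)) U_(p.2)%MM.
  apply/mnmP => j; rewrite mnm_sumE mE.
  rewrite -(pair_big_dep predT (fun i l : 'I_n => (i < l)%N && (k i == k l))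
             (fun i l : 'I_n => U_(l)%MM j)) /=.
  apply: eq_bigr => i _; rewrite big_mkcond (bigD1 j) //= mnm1E eqxx big1.
    by rewrite addn0; case: ifP.
  by move=> l lj; rewrite mnm1E (negbTE lj); case: ifP.
apply: lead_homog_prod => // -[i j] /= /andP[ij _].
have ne : (U_(i) == U_(j) :> 'X_{1..n})%MM = false.
  apply/negbTE/eqP => /mnmP /(_ j); rewrite !mnm1E eqxx.
  by case: eqP ij => // ->; rewrite ltnn.
split.
  by rewrite mcoeff_msupp mcoeffB !mcoeffX eqxx ne sub0r oppr_eq0 oner_eq0.
move=> m' /msuppB_le; rewrite mem_cat !msuppX !inE => /orP[] /eqP ->.
  by rewrite !mdeg1; split=> //; apply: inc.
by split=> //; apply: monomial_order_refl Hle _.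
Qed.

(** The lattice word [e] below [m] is the leading exponent of the polynomial of the
    coloring of the entries by their columns. *)
Lemma init_word_lead (K : fieldType) n la (le : rel 'X_{1..n}) (m : 'X_{1..n}) :
  (0 < n)%N -> (forall r, nth 0 la r.+1 <= nth 0 la r)%N -> sumn la = n ->
  monomial_order le -> increasing_vars le -> init_word la m ->
  exists2 p : {mpoly K[n]}, specht_ideal K n la p & lead_homog le p m.
Proof.
move=> n_gt0 la_anti la_sum Hle inc [e [/all2_leqP [sz em] He dom]].
have szn : size e = n by rewrite sz size_tuple.
pose k (i : 'I_n) := nth 0%N (columns e) i.
pose u := [multinom nth 0%N e i | i < n].
have um : (u <= m)%MM.
  by apply/mnm_lepP => i; rewrite mnmE (mnm_nth 0) em.
exists ('X_[m - u] * color_poly K k).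
  apply: ideal_genMl; apply: color_poly_in_specht => // c.
  rewrite (leq_trans (dominated_columns He dom _ _)) ?szn //.
  rewrite /num_lt_color /num_lt -sum1_count (big_nth 0%N) size_columns szn.
  by rewrite big_mkord big_mkcond.
rewrite -{2}(submK um); apply: lead_homogM => //; first exact: lead_homogX.
apply: lead_homog_color_poly => // j.
have je : (j < size e)%N by rewrite szn ltn_ord.
rewrite mnmE -(mult_take_columns He je) /mult -sum1_count.
rewrite (big_nth 0%N) size_take size_columns je big_mkord big_mkcond /=.
pose F i := if nth 0%N (take j (columns e)) i == nth 0%N (columns e) j
            then 1%N else 0%N.
rewrite (big_ord_widen n F) 1?ltnW ?ltn_ord // /F.
rewrite big_mkcond; apply: eq_bigr => i _.
by case: ltnP => //= ij; rewrite nth_take // /k; case: ifP.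
Qed.

(** If [m] were not an initial word, all the monomials of the support that are
    initial words could be eliminated one after the other, in decreasing order,
    leaving [m] in place; the result would contradict [specht_ideal_support]. *)
Lemma lead_init_word (K : fieldType) n la (le : rel 'X_{1..n})
    (p : {mpoly K[n]}) (m : 'X_{1..n}) :
  (0 < n)%N -> (forall r, nth 0 la r.+1 <= nth 0 la r)%N -> sumn la = n ->
  monomial_order le -> increasing_vars le ->
  specht_ideal K n la p -> leading_monomial le p m -> init_word la m.
Proof.
move=> n_gt0 la_anti la_sum Hle inc Ip [mp mlead]; apply: contrapT => nm.
have le_anti := monomial_order_anti Hle.
have le_trans := monomial_order_trans Hle.
pose d := msize p.
pose P (u : 'X_{1..n}) := `[< init_word la u >] && le u m.
pose s := sort (fun a b => le b a)
  [seq u <- [seq bmnm b | b <- enum {: 'X_{1..n < d}}] | P u].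
have s_sorted : sorted (fun a b => le b a) s.
  by apply: sort_sorted => a b; apply: (monomial_order_total Hle).
have s_mem u : (u \in s) = (mdeg u < d)%N && P u.
  rewrite mem_sort mem_filter andbC; congr andb; apply/mapP/idP => [[b _ ->]|ud].
    exact: bmdeg.
  by exists (BMultinom ud) => //; rewrite mem_enum.
have p_s : forall u : 'X_{1..n}, u \in msupp p ->
    (mdeg u < d)%N /\ (init_word la u -> u \in s).
  move=> u up; split=> [|uI]; first exact: msize_mdeg_lt.
  rewrite s_mem msize_mdeg_lt //=; apply/andP; split; first exact/asboolP.
  exact: mlead.
have sP u : u \in s -> init_word la u /\ le u m.
  by rewrite s_mem => /and3P [_ /asboolP].
have s_closed (a u : 'X_{1..n}) :
    a \in s -> init_word la u -> (mdeg u < d)%N -> le u a -> u \in s.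
  move=> /sP [_ am] uI ud ua; rewrite s_mem ud /=; apply/andP; split.
    exact/asboolP.
  exact: le_trans ua am.
have : forall (q : {mpoly K[n]}),
    specht_ideal K n la q -> m \in msupp q ->
    (forall u : 'X_{1..n}, u \in msupp q ->
      (mdeg u < d)%N /\ (init_word la u -> u \in s)) ->
    False; last by move/(_ p Ip mp p_s).
elim: s s_sorted sP s_closed {s_mem p_s} =>
  [|a s IH] s_sorted sP s_closed q Iq mq qs.
  have q_nz : q != 0 by apply: contraTneq mq => ->; rewrite msupp0.
  by have [u uq /(proj2 (qs u uq))] := specht_ideal_support la_anti Iq q_nz.
have s_le u : u \in s -> le u a.
  have trans : transitive (fun a b : 'X_{1..n} => le b a).
    by move=> y x z xy yz; apply: le_trans yz xy.
  by move: s_sorted; rewrite /= (path_sortedE trans) => /andP[/allP H _] /H.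
have sub (u : 'X_{1..n}) : u \in s -> u \in a :: s.
  by rewrite inE orbC => ->.
have {IH} := IH (path_sorted s_sorted) (fun u us => sP u (sub u us)).
have cl (b u : 'X_{1..n}) :
    b \in s -> init_word la u -> (mdeg u < d)%N -> le u b -> u \in s.
  move=> bs uI ud ub; have := s_closed b u (sub b bs) uI ud ub.
  rewrite inE => /orP[/eqP ua|//]; suff -> : u = b by [].
  by apply: le_anti; rewrite ub ua s_le.
move=> /(_ cl) IH.
have [aq|naq] := boolP (a \in msupp q); last first.
  apply: (IH q) => // u uq; have [ud us] := qs u uq; split=> // /us.
  by rewrite inE => /orP[/eqP ua|//]; rewrite -ua uq in naq.
have [aI am] := sP a (mem_head _ _).
have [g Ig [ag glead]] := init_word_lead K n_gt0 la_anti la_sum Hle inc aI.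
have ad : (mdeg a < d)%N by have [] := qs a aq.
apply: (IH (q - (q@_a / g@_a) *: g)).
- by apply: ideal_genB => //; rewrite -mul_mpolyC; apply: ideal_genMl.
- have mg : g@_m = 0.
    apply/eqP; rewrite mcoeff_eq0; apply/negP => /glead [ma _].
    by apply: nm; suff -> : m = a by []; apply: le_anti; rewrite ma am.
  by rewrite mcoeff_msupp mcoeffB mcoeffZ mg mulr0 subr0 -mcoeff_msupp.
move=> u ur.
have ua : u != a.
  apply: contraTneq ur => ->; rewrite mcoeff_msupp mcoeffB mcoeffZ divfK.
    by rewrite subrr eqxx.
  by rewrite -mcoeff_msupp.
have : u \in msupp q \/ u \in msupp g.
  apply/orP; rewrite -mem_cat; move/msuppB_le: ur; rewrite !mem_cat.
  by case/orP => [->//|/msuppZ_le ->]; rewrite orbT.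
case=> [/qs [ud us]|/glead [lua dua]].
  by split=> // /us; rewrite inE (negbTE ua).
split=> [|uI]; first by rewrite dua.
have := s_closed a u (mem_head _ _) uI; rewrite dua => /(_ ad lua).
by rewrite inE (negbTE ua).
Qed.

(** * Permutations of the variables *)

Definition mnm_perm n (m : 'X_{1..n}) (s : 'S_n) : 'X_{1..n} :=
  [multinom m (s i) | i < n].

Lemma mnm_permE n (m : 'X_{1..n}) (s : 'S_n) i : mnm_perm m s i = m (s i).
Proof. exact: mnmE. Qed.

Lemma mnm_permM n (m : 'X_{1..n}) (s t : 'S_n) :
  mnm_perm m (s * t)%g = mnm_perm (mnm_perm m t) s.
Proof. by apply/mnmP => i; rewrite !mnm_permE permM. Qed.

Lemma mnm_perm1 n (m : 'X_{1..n}) : mnm_perm m 1%g = m.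
Proof. by apply/mnmP => i; rewrite mnm_permE perm1. Qed.

Lemma mnm_permK n (s : 'S_n) :
  cancel (fun m => mnm_perm m s) (fun m => mnm_perm m s^-1%g).
Proof. by move=> m; rewrite -mnm_permM mulVg mnm_perm1. Qed.

Lemma mnm_permD n (m1 m2 : 'X_{1..n}) (s : 'S_n) :
  mnm_perm (m1 + m2)%MM s = (mnm_perm m1 s + mnm_perm m2 s)%MM.
Proof. by apply/mnmP => i; rewrite !(mnm_permE, mnmDE). Qed.

Lemma mnm_perm0 n (s : 'S_n) : mnm_perm 0%MM s = 0%MM.
Proof. by apply/mnmP => i; rewrite mnm_permE !mnm0E. Qed.

Lemma mnm_permU n (i : 'I_n) (s : 'S_n) : mnm_perm U_(s i)%MM s = U_(i)%MM.
Proof.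
by apply/mnmP => j; rewrite mnm_permE !mnm1E (inj_eq perm_inj).
Qed.

Lemma mcoeff_msym (K : fieldType) n (p : {mpoly K[n]}) (s : 'S_n) m :
  (msym s p)@_m = p@_(mnm_perm m s).
Proof. exact: mcoeff_sym. Qed.

Lemma msym_specht_ideal (K : fieldType) n la (p : {mpoly K[n]}) (s : 'S_n) :
  specht_ideal K n la p -> specht_ideal K n la (msym s p).
Proof.
move=> [u [Gu ->]]; exists [seq (msym s v.1, msym s v.2) | v <- u]; split.
  move=> v /mapP [w /Gu [T T_bij wT] ->] /=; exists (s \o T).
    by apply: bij_comp => //; exists (s^-1)%g; [apply: permK | apply: permKV].
  rewrite wT /specht_poly rmorph_prod; apply: eq_bigr => b _.
  rewrite rmorph_prod; apply: eq_bigr => b' _.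
  by rewrite rmorphB /= /msym !mmapX !mmap1U.
by rewrite raddf_sum big_map; apply: eq_bigr => v _; exact: rmorphM.
Qed.

Definition perm_order n (le : rel 'X_{1..n}) (s : 'S_n) : rel 'X_{1..n} :=
  fun m1 m2 => le (mnm_perm m1 s) (mnm_perm m2 s).

Lemma perm_order_monomial n (le : rel 'X_{1..n}) (s : 'S_n) :
  monomial_order le -> monomial_order (perm_order le s).
Proof.
move=> Hle; split.
- by move=> m; apply: monomial_order_refl Hle _.
- move=> m1 m2 /(monomial_order_anti Hle).
  exact: (can_inj (mnm_permK s)).
- by move=> m2 m1 m3; apply: monomial_order_trans Hle _ _ _.
- by move=> m1 m2; apply: monomial_order_total Hle _ _.
- by move=> m; rewrite /perm_order mnm_perm0; apply: monomial_order_ge0 Hle _.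
- by move=> m1 m2 m; rewrite /perm_order !mnm_permD; apply: monomial_order_add.
Qed.

Definition sorting_perm n (le : rel 'X_{1..n}) (s : 'S_n) : Prop :=
  forall i j : 'I_n, (i < j)%N -> le U_(s i)%MM U_(s j)%MM.

(** Renaming the variables reduces this to the case of increasing variables. *)
Lemma lead_init_word_perm (K : fieldType) n la (le : rel 'X_{1..n}) (s : 'S_n)
    (m : 'X_{1..n}) :
  (0 < n)%N -> (forall r, nth 0 la r.+1 <= nth 0 la r)%N -> sumn la = n ->
  monomial_order le -> sorting_perm le s ->
  (exists2 p : {mpoly K[n]}, specht_ideal K n la p & leading_monomial le p m) <->
  init_word la (mnm_perm m s).
Proof.
move=> n_gt0 la_anti la_sum Hle le_s.
have Hle' := perm_order_monomial s^-1%g Hle.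
have inc : increasing_vars (perm_order le s^-1%g).
  move=> i j ij; rewrite /perm_order -{1}(permK s i) -{1}(permK s j) !mnm_permU.
  exact: le_s.
split=> [[p Ip [pm plead]]|].
  apply: (lead_init_word n_gt0 la_anti la_sum Hle' inc
            (msym_specht_ideal s^-1%g Ip)).
  split; first by rewrite mcoeff_msupp mcoeff_msym mnm_permK -mcoeff_msupp.
  move=> u; rewrite mcoeff_msupp mcoeff_msym -mcoeff_msupp => /plead.
  by rewrite /perm_order mnm_permK.
move/(init_word_lead K n_gt0 la_anti la_sum Hle' inc) => [q Iq [mq qlead]].
exists (msym s q); first exact: msym_specht_ideal.
split; first by rewrite mcoeff_msupp mcoeff_msym -mcoeff_msupp.
move=> u; rewrite mcoeff_msupp mcoeff_msym -mcoeff_msupp => /qlead [].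
by rewrite /perm_order !mnm_permK.
Qed.

Lemma sorting_perm_exists n (le : rel 'X_{1..n}) :
  monomial_order le -> exists s, sorting_perm le s.
Proof.
move=> Hle; pose R (i j : 'I_n) := le U_(i)%MM U_(j)%MM.
pose t := sort R (enum 'I_n).
have szt : size t = n by rewrite size_sort size_enum_ord.
have t_uniq : uniq t by rewrite sort_uniq enum_uniq.
have R_trans : transitive R by move=> y x z; apply: (monomial_order_trans Hle).
have t_sorted : sorted R t.
  by apply: sort_sorted => x y; apply: (monomial_order_total Hle).
have [n0|n_gt0] := posnP n.
  by exists 1%g => i; have := ltn_ord i; rewrite {2}n0 ltn0.
pose x0 := Ordinal n_gt0.
have t_inj : injective (fun i : 'I_n => nth x0 t i).
  by move=> i j /eqP; rewrite nth_uniq ?szt // => /eqP /val_inj.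
exists (perm t_inj) => i j ij; rewrite !permE.
by apply: (sorted_ltn_nth R_trans x0 t_sorted i j) => //; rewrite inE szt.
Qed.

(** The graded lexicographic order with the variables suitably permuted. *)
Lemma monomial_order_exists n (s : 'S_n) :
  exists2 le : rel 'X_{1..n}, monomial_order le & sorting_perm le s.
Proof.
pose glex : rel 'X_{1..n} := fun m1 m2 => (m1 <= m2)%O.
have Hglex : monomial_order glex.
  split.
  - exact: Order.POrderTheory.le_refl.
  - exact: Order.POrderTheory.le_anti.
  - exact: Order.POrderTheory.le_trans.
  - exact: lemc_total.
  - by move=> m; apply: Order.BPreorderTheory.le0x.
  - by move=> m1 m2 m; rewrite /glex lemc_add2l.
(* In this order the first variable is the largest one. *)
pose t : 'S_n := (perm (@rev_ord_inj n) * s)%g.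
exists (perm_order glex t); first exact: perm_order_monomial.
move=> i j ij.
have E k : s k = t (rev_ord k) by rewrite permM permE rev_ordK.
rewrite /perm_order !E !mnm_permU; apply/Order.POrderTheory.ltW/ltmcP.
  by rewrite !mdeg1.
exists (rev_ord j) => [k kj|]; rewrite !mnm1E.
  by do 2 (case: eqP => [/(congr1 val) /= ?|_]; first by move: kj ij => /=; lia).
rewrite eqxx; case: eqP => // /rev_ord_inj ij'.
by rewrite ij' ltnn in ij.
Qed.

Local Close Scope ring_scope.

Lemma mnm_perm_swap n (m : 'X_{1..n}) (i j : 'I_n) w a b z :
  j = i.+1 :> nat -> size w = i -> m = w ++ a :: b :: z :> seq nat ->
  mnm_perm m (tperm i j) = w ++ b :: a :: z :> seq nat.
Proof.
move=> ij wi mE; have szm : size (w ++ a :: b :: z) = n.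
  by rewrite -mE size_tuple.
apply: (@eq_from_nth _ 0); first by rewrite size_tuple -szm !size_cat.
move=> l; rewrite size_tuple => ln; rewrite -(mnm_nth 0 _ (Ordinal ln)) mnm_permE.
rewrite (mnm_nth 0) mE !nth_cat wi.
case: tpermP => [E|E|/eqP ni /eqP nj].
- have -> : l = i :> nat by rewrite -E.
  by rewrite ij ltnn subnn ltnNge leqnSn subSnn.
- have -> : l = j :> nat by rewrite -E.
  by rewrite ij ltnn subnn ltnNge leqnSn subSnn.
rewrite /=; case: ltnP => // il.
have li : l - i != 0 by move: ni; rewrite -val_eqE /=; lia.
have lj : l - i != 1 by move: nj; rewrite -val_eqE /= ij; lia.
by case: (l - i) li lj => [|[|]].
Qed.

Lemma mnm_split n (m : 'X_{1..n}) (i j : 'I_n) : j = i.+1 :> nat ->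
  exists w z, size w = i /\ m = w ++ m i :: m j :: z :> seq nat.
Proof.
move=> ij; exists (take i m), (drop j.+1 m).
rewrite size_take size_tuple ltn_ord; split=> //.
rewrite -{1}(cat_take_drop i m) (drop_nth 0) ?size_tuple ?ltn_ord //.
rewrite -ij (drop_nth 0) ?size_tuple ?ltn_ord //.
by rewrite !(mnm_nth 0).
Qed.

Lemma init_word_perm_desc n la (m : 'X_{1..n}) (i j : 'I_n) :
  j = i.+1 :> nat -> m j < m i -> init_word la m ->
  init_word la (mnm_perm m (tperm i j)).
Proof.
move=> ij lt; have [w [z [wi mE]]] := mnm_split m ij.
by rewrite (mnm_perm_swap ij wi mE) mE; apply: init_word_swap.
Qed.

Lemma num_lt_mnm n (m : 'X_{1..n}) r : num_lt r m = \sum_(i < n) (m i < r).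
Proof.
rewrite /num_lt -sum1_count (big_nth 0) size_tuple big_mkord big_mkcond /=.
by apply: eq_bigr => i _; rewrite (mnm_nth 0); case: ifP.
Qed.

Definition preserves_init n la (s : 'S_n) : Prop :=
  forall m : 'X_{1..n}, init_word la (mnm_perm m s) <-> init_word la m.

(** The criterion of [init_word_tail] depends on the last [k + 1] letters only
    through their multiplicities. *)
Lemma init_word_perm_tail n la k (s : 'S_n) (m : 'X_{1..n}) :
  (forall r, r.+1 < size la -> nth 0 la r.+1 + k <= nth 0 la r) ->
  sumn la = n -> (forall i : 'I_n, i + k.+1 < n -> s i = i) ->
  init_word la m -> init_word la (mnm_perm m s).
Proof.
move=> gap la_sum fix_s [e [/all2_leqP [sz em] He dom]].
have esz : size e = n by rewrite sz size_tuple.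
pose u : 'X_{1..n} := [multinom nth 0 e i | i < n].
have uE : u = e :> seq nat.
  apply: (@eq_from_nth _ 0); first by rewrite size_tuple esz.
  by move=> i; rewrite size_tuple => ilt; rewrite -(mnm_nth 0 _ (Ordinal ilt)) mnmE.
apply: (@init_word_up _ (mnm_perm u s)).
  by apply: all2_leq_mnm => i; rewrite !mnm_permE !(mnm_nth 0) uE em.
apply: (@init_word_tail _ k (n - k.+1)) => //.
- by rewrite size_tuple.
- by rewrite size_tuple; lia.
- have -> : take (n - k.+1) (mnm_perm u s) = take (n - k.+1) e.
    apply: (@eq_from_nth _ 0); first by rewrite !size_take size_tuple esz.
    move=> i; rewrite size_take size_tuple => ilt.
    have ik : i + k.+1 < n by move: ilt; case: ifP; lia.
    have iN : i < n - k.+1 by lia.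
    have ltn : i < n by lia.
    rewrite !nth_take // -uE -!(mnm_nth 0 _ (Ordinal ltn)) mnm_permE.
    by rewrite fix_s.
  exact: lattice_word_take.
- move=> r; rewrite num_lt_mnm; apply: leq_trans (dom r).
  rewrite -uE num_lt_mnm [X in _ <= X](reindex_inj (@perm_inj _ s)) /=.
  by apply: leq_sum => i _; rewrite mnm_permE.
Qed.

Lemma preserves_init_tail n la k (s : 'S_n) :
  (forall r, r.+1 < size la -> nth 0 la r.+1 + k <= nth 0 la r) ->
  sumn la = n -> (forall i : 'I_n, i + k.+1 < n -> s i = i) ->
  preserves_init la s.
Proof.
move=> gap la_sum fix_s m; split; last exact: (init_word_perm_tail gap).
move/(init_word_perm_tail (s := s^-1%g) gap la_sum); rewrite mnm_permK; apply.
by move=> i ik; apply: (@perm_inj _ s); rewrite permKV fix_s.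
Qed.

(** The total exponent of each variable, over the initial words with letters at
    most [B], is an invariant of the permutations considered.  By
    [init_word_perm_desc] it increases weakly with the variable, and it increases
    strictly at a position where some initial word does not survive the exchange
    of two neighbours. *)
Lemma preserves_init_fix n la (s : 'S_n) k :
  sumn la = n -> (forall i, i + k + 2 <= n -> swap_sensitive la i) ->
  preserves_init la s -> forall i : 'I_n, i + k.+1 < n -> s i = i.
Proof.
move=> la_sum bad Hs i0; have [N] := ubnP (i0 : nat).
elim: N i0 => // N IH i0 iN ik.
have fixed (j : 'I_n) : j < i0 -> s j = j.
  by move=> ji; apply: IH; lia.
have [w [a [b [z [wi sz good nbad]]]]] := bad i0 ltac:(lia).
pose B := \max_(x <- w ++ a :: b :: z) x.
pose T := {ffun 'I_n -> 'I_B.+1}.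
pose mono (f : T) : 'X_{1..n} := [multinom (f i : nat) | i < n].
pose L f := `[< init_word la (mono f) >].
pose D i := \sum_(f : T) L f * f i.
pose act (t : 'S_n) (f : T) : T := [ffun i => f (t i)].
have actE t f : mono (act t f) = mnm_perm (mono f) t.
  by apply/mnmP => i; rewrite mnm_permE !mnmE ffunE.
have act_inj t : injective (act t).
  move=> f g /ffunP fg; apply/ffunP => i.
  by have := fg (t^-1%g i); rewrite !ffunE permKV.
have D_inv i : D (s i) = D i.
  rewrite /D [RHS](reindex_inj (act_inj s)) /=; apply: eq_bigr => f _.
  by rewrite ffunE /L actE; congr (nat_of_bool _ * _); apply/asboolP/asboolP => /Hs.
pose swap (i j : 'I_n) f := act (tperm i j) f.
have D_swap (i j : 'I_n) : j = i.+1 :> nat ->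
  D i + D i = \sum_f (L f * f i + L (swap i j f) * f j) /\
  D j + D j = \sum_f (L f * f j + L (swap i j f) * f i).
  move=> ij; rewrite !big_split /=; split; congr (_ + _).
    rewrite /D (reindex_inj (act_inj (tperm i j))) /=; apply: eq_bigr => f _.
    by rewrite ffunE tpermL.
  rewrite /D (reindex_inj (act_inj (tperm i j))) /=; apply: eq_bigr => f _.
  by rewrite ffunE tpermR.
have L_desc (i j : 'I_n) (f : T) :
    j = i.+1 :> nat -> f j < f i -> L f -> L (swap i j f).
  move=> ij lt /asboolP Lf; apply/asboolP; rewrite /swap actE.
  by apply: init_word_perm_desc => //; rewrite !mnmE.
have swapK i j f : swap i j (swap i j f) = f.
  by apply/ffunP => l; rewrite !ffunE tpermK.
have term_le (i j : 'I_n) (f : T) : j = i.+1 :> nat ->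
    L f * f i + L (swap i j f) * f j <= L f * f j + L (swap i j f) * f i.
  move=> ij; have := L_desc i j f ij; have := L_desc i j (swap i j f) ij.
  rewrite swapK !ffunE tpermL tpermR.
  by case: (L f) (L (swap i j f)) => [] []; rewrite ?mul1n ?mul0n; lia.
have D_le (i j : 'I_n) : j = i.+1 :> nat -> D i <= D j.
  move=> ij; have [Ei Ej] := D_swap i j ij.
  have : D i + D i <= D j + D j.
    by rewrite Ei Ej; apply: leq_sum => f _; apply: term_le.
  lia.
have i1n : i0.+1 < n by lia.
pose i1 := Ordinal i1n.
have D_lt : D i0 < D i1.
  have [Ei Ej] := D_swap i0 i1 erefl.
  have szm : size (w ++ a :: b :: z) == n by rewrite sz la_sum.
  pose m : 'X_{1..n} := Multinom (Tuple szm).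
  pose f0 : T := [ffun i => inord (m i)].
  have f0E i : f0 i = m i :> nat.
    rewrite ffunE inordK // ltnS /B (big_nth 0) big_mkord (mnm_nth 0).
    have iw : i < size (w ++ a :: b :: z) by rewrite (eqP szm).
    exact: (@leq_bigmax _ (fun l : 'I_(size (w ++ a :: b :: z)) => nth 0 _ l)
      (Ordinal iw)).
  have mE : mono f0 = m by apply/mnmP => i; rewrite mnmE f0E.
  have Lf0 : L f0 by apply/asboolP; rewrite mE.
  have nLf0 : L (swap i0 i1 f0) = false.
    apply/asboolP; rewrite /swap actE mE.
    by rewrite (@mnm_perm_swap _ m i0 i1 w a b z).
  have lt0 : f0 i0 < f0 i1.
    rewrite ltnNge leq_eqVlt; apply/negP => /orP[/eqP eq|lt].
      suff E : swap i0 i1 f0 = f0 by rewrite E Lf0 in nLf0.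
      apply/ffunP => l; rewrite [LHS]ffunE.
      by case: tpermP => [->|->|//]; apply: val_inj; rewrite /= eq.
    by rewrite (L_desc i0 i1 f0 erefl lt Lf0) in nLf0.
  have : D i0 + D i0 < D i1 + D i1.
    rewrite Ei Ej (bigD1 f0) //= [X in _ < X](bigD1 f0) //=.
    rewrite -addSn leq_add //; first by rewrite Lf0 nLf0; lia.
    by apply: leq_sum => f _; apply: term_le.
  lia.
have D_far (j : 'I_n) : i0 < j -> D i0 < D j.
  case: j => j jn /=; elim: j jn => // j IHj jn; rewrite ltnS leq_eqVlt.
  case/orP => [/eqP ij|ij].
    by have -> : Ordinal jn = i1 by apply: val_inj; rewrite /= ij.
  have jn' : j < n by lia.
  by apply: leq_trans (IHj jn' ij) _; apply: D_le.
case: (ltngtP (s i0) i0) => [lt|gt|/val_inj //].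
  have /(fixed _)/perm_inj E := lt; by move: lt; rewrite E ltnn.
by have := D_far _ gt; rewrite D_inv ltnn.
Qed.

(** * Counting the initial ideals *)

Definition perm_init_ideal (K : fieldType) n la (s : 'S_n) : set {mpoly K[n]} :=
  ideal_gen [set q | exists2 m, init_word la (mnm_perm m s) & q = 'X_[m]%R]%classic.
Arguments perm_init_ideal K {n} la s.

(** A monomial lies in a monomial ideal only if some generator divides it. *)
Lemma mem_perm_init_ideal (K : fieldType) n la (s : 'S_n) (m : 'X_{1..n}) :
  perm_init_ideal K la s 'X_[m]%R <-> init_word la (mnm_perm m s).
Proof.
split=> [[u [Gu mE]]|ms]; last by apply: ideal_gen_incl; exists m.
have [v vu nz] : exists2 v, v \in u & mcoeff m (v.1 * v.2)%R != 0%R.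
  apply: contrapT => no; have := congr1 (mcoeff m) mE.
  rewrite mcoeffX eqxx raddf_sum big_seq big1 => [/eqP|v vu].
    by rewrite oner_eq0.
  by apply/eqP; apply: contrapT => /negP nz; apply: no; exists v.
have [m' m's vE] := Gu v vu.
move: nz; rewrite -mcoeff_msupp vE => /msuppM_le /allpairsP [[m1 m2] /= [_]].
rewrite msuppX inE => /eqP -> ->; apply: (init_word_up _ m's).
apply: (@all2_leq_mnm _ (mnm_perm m' s) (mnm_perm (m1 + m')%MM s)) => i.
by rewrite !mnm_permE mnmDE leq_addl.
Qed.

Lemma initial_ideal_perm (K : fieldType) n la (le : rel 'X_{1..n}) (s : 'S_n) :
  (0 < n)%N -> (forall r, nth 0 la r.+1 <= nth 0 la r)%N -> sumn la = n ->
  monomial_order le -> sorting_perm le s ->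
  initial_ideal le (specht_ideal K n la) = perm_init_ideal K la s.
Proof.
move=> n_gt0 la_anti la_sum Hle le_s; congr ideal_gen; apply/predeqP => q; split.
  move=> [p [m [Ip pm ->]]]; exists m => //.
  by apply/(lead_init_word_perm K m n_gt0 la_anti la_sum Hle le_s); exists p.
move=> [m /(lead_init_word_perm K m n_gt0 la_anti la_sum Hle le_s) [p Ip pm] ->].
by exists p, m.
Qed.

Lemma perm_init_ideal_eq (K : fieldType) n la (s t : 'S_n) :
  perm_init_ideal K la s = perm_init_ideal K la t <->
  preserves_init la (s * t^-1)%g.
Proof.
split=> [E m|st].
  have -> : mnm_perm m (s * t^-1)%g = mnm_perm (mnm_perm m t^-1%g) s.
    exact: mnm_permM.
  rewrite -(mem_perm_init_ideal K) E mem_perm_init_ideal.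
  by rewrite -mnm_permM mulgV mnm_perm1.
congr ideal_gen; apply/predeqP => q.
by split=> -[m ms ->]; exists m => //; move: ms;
  have := st (mnm_perm m t); rewrite -mnm_permM mulgKV => -[].
Qed.

Lemma min_gapP la : 1 < size la -> (forall r, nth 0 la r.+1 <= nth 0 la r) ->
  (forall r, r.+1 < size la -> nth 0 la r.+1 + min_gap la <= nth 0 la r) /\
  exists2 q, q.+1 < size la & nth 0 la q = nth 0 la q.+1 + min_gap la.
Proof.
move=> la2 la_anti.
set F := fun i => nth 0 la i.-1 - nth 0 la i; set x := head 0 la.
have lower (r : seq nat) i : i \in r -> \big[minn/x]_(j <- r) F j <= F i.
  elim: r => // y r IH; rewrite inE big_cons geq_min => /orP[/eqP <-|/IH ->].
    by rewrite leqnn.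
  by rewrite orbT.
have attained (r : seq nat) : \big[minn/x]_(j <- r) F j = x \/
    exists2 i, i \in r & \big[minn/x]_(j <- r) F j = F i.
  elim: r => [|y r IH]; first by left; rewrite big_nil.
  rewrite big_cons /minn; case: ifP => _.
    by right; exists y => //; apply: mem_head.
  by case: IH => [|[i ir]]; [left | right; exists i => //; rewrite inE ir orbT].
have -> : min_gap la = \big[minn/x]_(i <- index_iota 1 (size la)) F i by [].
have gap r : r.+1 < size la -> \big[minn/x]_(i <- index_iota 1 (size la)) F i <=
    nth 0 la r - nth 0 la r.+1.
  by move=> rs; apply: (lower _ r.+1); rewrite mem_index_iota rs.
have := attained (index_iota 1 (size la)).
move: (\big[_/_]_(_ <- _) _) gap => g gap gE.
split=> [r rs|]; first by have := gap r rs; have := la_anti r; lia.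
case: gE => [gx|[i]].
  (* If the minimum is the default value [la_0], then the first gap is [la_0]. *)
  by exists 0 => //; have := gap 0 la2; have := la_anti 0; rewrite gx /x -nth0; lia.
rewrite mem_index_iota => /andP[i1 i2] ->; exists i.-1; rewrite prednK //.
by rewrite /F; have := la_anti i.-1; rewrite prednK //; lia.
Qed.

Theorem theorem3p3 (K : fieldType) (n : nat) (la : seq nat)
    (hn : (0 < n)%N) (hla : is_partition n la)
    (hm : (2 <= size la)%N) (hpos : (0 < last 0 la)%N) :
  (initial_ideals (specht_ideal K n la) #= `I_(n`! %/ (min_gap la).+1`!))%card.
Proof.
case: hla => la_sorted la_sum; have la_anti := partition_anti la_sorted.
have la_pos r : r < size la -> 0 < nth 0 la r.
  move=> rs; apply: leq_trans hpos _; rewrite -nth_last.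
  have : r <= (size la).-1 by lia.
  move=> /subnK <-; elim: (_ - r) => // d; rewrite addSn.
  exact: leq_trans (la_anti _).
have [gap [q qs gapq]] := min_gapP hm la_anti.
set k := min_gap la in gap gapq *.
have bad i : i + k + 2 <= n -> swap_sensitive la i.
  by rewrite -la_sum; apply: (swap_sensitive_exists la_anti la_pos qs gapq).
have kn : k.+1 <= n.
  have := sumn_take_le la q.+2; rewrite !sumn_takeS la_sum gapq.
  by have := la_pos q.+1 qs; lia.
pose A : {set 'I_n} := [set i : 'I_n | n <= i + k.+1].
have cardA : #|A| = k.+1.
  have : #|~: A| = n - k.+1.
    have -> : ~: A = [set i : 'I_n | i < n - k.+1].
      by apply/setP => i; rewrite !inE; lia.
    rewrite -sum1dep_card -(big_ord_widen n (fun=> 1) (leq_subr k.+1 n)).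
    by rewrite sum1_card card_ord.
  by have := cardsC A; rewrite card_ord; lia.
pose H := Sym_group A.
have H_iff s : preserves_init la s <-> s \in H.
  rewrite inE; split=> [Hs|Hs].
    apply/fintype.subsetP => i; rewrite !inE; apply: contraR; rewrite -ltnNge => ik.
    by apply/eqP; apply: (preserves_init_fix la_sum bad Hs).
  apply: (preserves_init_tail gap la_sum) => i ik; apply: (out_perm Hs).
  by rewrite inE -ltnNge.
pose C := enum (rcosets H [set: 'S_n]).
pose J (c : {set 'S_n}) : set {mpoly K[n]} := perm_init_ideal K la (repr c : 'S_n).
have J_coset c s : c \in rcosets H [set: 'S_n] -> s \in c ->
    J c = perm_init_ideal K la s.
  move=> /rcosetsP [t _ ->] sc; apply/perm_init_ideal_eq/H_iff.
  have := mem_repr_rcoset H t; rewrite -(rcoset_eqP sc).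
  by rewrite mem_rcoset.
have szC : size C = n`! %/ k.+1`!.
  rewrite -cardE -[#|_|]/(#|[set: 'S_n] : H|)%g -divgS ?finset.subsetT //.
  by rewrite cardsT card_Sn card_Sym cardA.
have nthC i : i < n`! %/ k.+1`! -> nth finset.set0 C i \in rcosets H [set: 'S_n].
  by rewrite -szC => iC; rewrite -mem_enum mem_nth.
have -> : initial_ideals (specht_ideal K n la) =
    ((fun i => J (nth finset.set0 C i)) @` `I_(n`! %/ k.+1`!))%classic.
  apply/predeqP => I; split=> [[le Hle ->]|[i /= /nthC iC <-]].
    have [s le_s] := sorting_perm_exists Hle.
    have sC : (H :* s)%g \in rcosets H [set: 'S_n].
      by apply/rcosetsP; exists s; rewrite ?finset.in_setT.
    exists (index (H :* s)%g C); first by rewrite /= -szC index_mem mem_enum.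
    rewrite nth_index ?mem_enum // (J_coset _ s) ?rcoset_refl //.
    by rewrite (initial_ideal_perm K hn la_anti la_sum Hle le_s).
  have [s _ cs] := rcosetsP iC.
  have [le Hle le_s] := monomial_order_exists s.
  exists le => //; rewrite (initial_ideal_perm K hn la_anti la_sum Hle le_s).
  by rewrite (J_coset _ s) // cs rcoset_refl.
apply: inj_card_eq => i j; rewrite !inE => iN jN /perm_init_ideal_eq/H_iff.
have repr_coset c : c \in rcosets H [set: 'S_n] -> c = (H :* repr c)%g.
  by case/rcosetsP => s _ ->; rewrite rcoset_repr.
rewrite -mem_rcoset => /rcoset_eqP.
rewrite -!repr_coset ?nthC // => /eqP.
by rewrite nth_uniq ?enum_uniq ?szC // => /eqP.
Qed.
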